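(* Let $\mathbb{F}=\mathbb{R}$ or $\mathbb{C}$, let $m,n\ge 2$ and $r,s\ge 1$ be integers, let $p\in(0,2)\cup(2,+\infty)$, and let $\Phi:M_{m,n}(\mathbb{F})\to M_{r,s}(\mathbb{F})$ be an $\mathbb{F}$-linear map. The following conditions are equivalent. (a) $S_p(\Phi(A))=S_p(A)$ for all $A\in M_{m,n}(\mathbb{F})$. (b) $S_p(\Phi(A))=S_p(A)$ for all $A\in M_{m,n}(\mathbb{F})$ with rank at most $2$. (c) There are $U\in U_r(\mathbb{F})$, $V\in U_s(\mathbb{F})$, and diagonal matrices $Q_1\in M_{q_1,q_1}(\mathbb{F})$, $Q_2\in M_{q_2,q_2}(\mathbb{F})$ with positive diagonal entries such that $S_p(Q_1\oplus Q_2)=1$ and $$\Phi(A)=U\begin{pmatrix} A\otimes Q_1 & 0 & 0\\ 0 & A^t\otimes Q_2 & 0\\ 0&0&0\end{pmatrix}V\qquad\text{for all } A\in M_{m,n}(\mathbb{F}).$$ Here $Q_1$ or $Q_2$ may be vacuous.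
   Context: $M_{m,n}(\mathbb{F})$ is the space of $m\times n$ matrices over $\mathbb{F}$; $A^t$ is the transpose, $A^*$ the conjugate transpose. $U_n(\mathbb{F})=\{A\in M_{n,n}(\mathbb{F}): A^*A=I_n\}$. For a matrix $A$ of size $m\times n$ with $h=\min\{m,n\}$ and singular values $s_1(A)\ge\cdots\ge s_h(A)$, and for $p>0$, $S_p(A)=\left(\sum_{j=1}^h s_j(A)^p\right)^{1/p}$. $\otimes$ is the Kronecker product. ''Vacuous'' means of size $0$, in which case the corresponding block is absent; zero blocks have whatever (possibly zero) sizes make the block matrix $r\times s$. *)

(* Defs.v *)
From HB Require Import structures.
From mathcomp Require Import all_boot all_order all_algebra.
From mathcomp Require Import spectral complex mxtens.
From mathcomp Require Import reals exp.

Set Implicit Arguments.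
Unset Strict Implicit.
Unset Printing Implicit Defensive.

Import Order.TTheory GRing.Theory Num.Theory.
Local Open Scope ring_scope.

Variant scalar_kind := RealScalars | ComplexScalars.

Definition scalar_field (R : realType) (k : scalar_kind) : numFieldType :=
  match k with RealScalars => R | ComplexScalars => R[i] end.

Definition conj_scalar (R : realType) (k : scalar_kind) :
    scalar_field R k -> scalar_field R k :=
  match k with RealScalars => id | ComplexScalars => Num.conj end.

Definition to_complex (R : realType) (k : scalar_kind) : scalar_field R k -> R[i] :=
  match k with RealScalars => real_complex R | ComplexScalars => id end.

Section MatrixNotions.
Variables (R : realType) (k : scalar_kind).
Local Notation F := (scalar_field R k).

Definition adjmx m n (A : 'M[F]_(m, n)) : 'M[F]_(n, m) :=
  (map_mx (@conj_scalar R k) A)^T.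

Definition unitary_mx n (U : 'M[F]_n) : Prop := adjmx U *m U = 1%:M.

(* The square roots of the eigenvalues of A^* A, with multiplicity and in
   nonincreasing order. A^* A has n eigenvalues; when m < n the last n - m of
   them are 0 and [take] drops them, leaving s_1(A) >= ... >= s_h(A) with
   h = min(m, n). A^* A is taken over the complex numbers because
   [spectral_diag] requires a closed field; its eigenvalues are real, so that
   [complex.Re] loses nothing. *)
Definition singular_values m n (A : 'M[F]_(m, n)) : seq R :=
  let lambda := spectral_diag (map_mx (@to_complex R k) (adjmx A *m A)) in
  take (minn m n)
    (sort >=%R [seq Num.sqrt (complex.Re (lambda 0 i)) | i <- enum 'I_n]).

Definition schatten (p : R) m n (A : 'M[F]_(m, n)) : R :=
  (\sum_(s <- singular_values A) s `^ p) `^ p^-1.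

Definition dsummx m1 n1 m2 n2 (A : 'M[F]_(m1, n1)) (B : 'M[F]_(m2, n2)) :
    'M[F]_(m1 + m2, n1 + n2) :=
  block_mx A 0 0 B.

Definition pos_diag q (Q : 'M[F]_q) : Prop :=
  is_diag_mx Q /\ forall i, 0 < Q i i.

End MatrixNotions.

(* Main.v *)
Require Import Defs.
From HB Require Import structures.
From mathcomp Require Import all_boot all_order all_algebra.
From mathcomp Require Import spectral complex mxtens.
From mathcomp Require Import reals exp.
From mathcomp Require Import sequences.
From mathcomp Require Import ring lra.

Set Implicit Arguments.
Unset Strict Implicit.
Unset Printing Implicit Defensive.

Import Order.TTheory GRing.Theory Num.Theory.
Local Open Scope ring_scope.

(** The Schatten functional is a spectral sum: S_p(A)^p is the sum of phi over
    the eigenvalues of A^H A, with phi(x) = x^(p/2).  When p > 2 this phi is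
    strictly convex on the nonnegative numbers, when p < 2 its opposite is.  For
    such a phi the sums satisfy Clarkson's inequality
      2 (phi(A) + phi(B)) <= phi(A + B) + phi(A - B),
    with equality exactly when A^H B = 0 and A B^H = 0 ([clarkson_eq],
    [specsum_disjointD], [specsum_disjointB]).  Both halves of the inequality come
    from Peierls' theorem: the sum of phi over the diagonal of a positive matrix
    is at most the sum of phi over its spectrum, and equality forces the matrix
    to be diagonal ([peierls]).  It is applied first to A + B and A - B in an
    eigenbasis of A^H A + B^H B, the Gram matrix of the column (A; B), and then
    to the adjoint of that column in an eigenbasis of its diagonal blocks.

    So a linear map Phi which preserves S_p on matrices of rank at most 2 sends
    two disjoint matrices of rank one (A^H B = 0 and A B^H = 0) to disjoint
    matrices ([schatten_preserver_disjoint]).  The rest is linear algebra over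
    the scalar field.  Write F_ij for the images of the matrix units.  Testing
    disjointness on the pairs obtained from e_i + e_k and e_k - e_i gives
      F_ij^h F_kl = 0 = F_ij F_kl^h,    F_ij^h F_il = F_kj^h F_kl,
      F_ij F_kj^h = F_il F_kl^h,
      F_ij F_ij^h + F_kl F_kl^h = F_il F_il^h + F_kj F_kj^h
    for i <> k and j <> l.  In the expected form A (x) Q1 (+) A^T (x) Q2 the matrix
    P = F_ij^h F_il is E_jl (x) Q1^2, so that an eigenvector of P P^h for a nonzero
    eigenvalue singles out an entry of Q1.  Transporting this vector by the F_ij
    and their adjoints yields isometries U and V^h with Phi(A) V^h = q U A and
    U^h Phi(A) = q A V, where q is that entry ([peel]).  If all these P vanish and
    Phi is not zero, the construction applies to A |-> Phi(A^T) and yields an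
    entry of Q2 ([nonzero_link]).  Subtracting the block leaves a map that still preserves disjointness and has smaller rank on
    a given matrix unit, so an induction splits Phi into blocks
    ([disjointness_preserver_decomposition]).  Gluing the isometries together and
    completing them to unitary matrices gives the normal form.

    Conversely, spectral sums are unitarily invariant, additive over direct sums
    and, for powers, multiplicative over Kronecker products.  Hence a map in normal
    form multiplies S_p by S_p(Q1 (+) Q2) ([schatten_normal_form]); this gives
    (a) from (c), and evaluating at a matrix unit shows that
    S_p(Q1 (+) Q2) = 1 in (c). *)

Local Notation "A ^H" := (map_mx Num.conj (trmx A))
  (at level 8, format "A ^H") : ring_scope.
Local Notation "A ^h" := (adjmx A) (at level 8, format "A ^h") : ring_scope.

(** * Characteristic polynomials *)
Section CharPoly.
Variable F : fieldType.

(** Sylvester's identity.  Both sides are the determinant of the block matrix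
    with rows ('X, A) and (B, 1), times 'X^n: eliminating B on the right gives
    one side, eliminating it on the left the other.  It gives at once that
    similar matrices have the same characteristic polynomial and that A^H A and
    A A^H have the same nonzero eigenvalues. *)
Lemma char_poly_mulC m n (A : 'M[F]_(m, n)) (B : 'M[F]_(n, m)) :
  char_poly (A *m B) * 'X^n = char_poly (B *m A) * 'X^m.
Proof.
pose a := map_mx polyC A; pose b := map_mx polyC B.
have Eab : char_poly_mx (A *m B) = 'X%:M - a *m b by rewrite /char_poly_mx map_mxM.
have Eba : char_poly_mx (B *m A) = 'X%:M - b *m a by rewrite /char_poly_mx map_mxM.
pose M := block_mx 'X%:M a b 1%:M.
have detM : \det M = char_poly (A *m B).
  have : M *m block_mx 1%:M 0 (- b) 1%:M = block_mx ('X%:M - a *m b) a 0 1%:M.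
    by rewrite mulmx_block !mulmx1 !mulmx0 !mulmxN !mul1mx !add0r subrr.
  move/(congr1 determinant); rewrite det_mulmx det_lblock det_ublock !det1 !mulr1.
  by rewrite /char_poly Eab.
have : block_mx 1%:M 0 (- b) 'X%:M *m M = block_mx 'X%:M a 0 ('X%:M - b *m a).
  rewrite mulmx_block !mul1mx !mul0mx !mulNmx !mulmx1 !addr0 addrC.
  by rewrite -scalar_mxC addrN [- _ + _]addrC.
move/(congr1 determinant); rewrite det_mulmx det_lblock det_ublock det1 mul1r.
by rewrite !det_scalar detM -Eba mulrC => ->; rewrite mulrC.
Qed.

Lemma char_poly_conj n (U V A : 'M[F]_n) : V *m U = 1%:M ->
  char_poly (U *m A *m V) = char_poly A.
Proof.
move=> VU; apply: (@mulIf _ 'X^n); first by rewrite expf_neq0 // polyX_eq0.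
by rewrite -mulmxA char_poly_mulC -mulmxA VU mulmx1.
Qed.

Lemma char_poly_tr n (A : 'M[F]_n) : char_poly A^T = char_poly A.
Proof.
rewrite /char_poly -[in RHS]det_tr; congr (\det _).
by rewrite /char_poly_mx linearB /= tr_scalar_mx map_trmx.
Qed.

Lemma char_poly_block n1 n2 (A : 'M[F]_n1) (B : 'M[F]_n2) :
  char_poly (block_mx A 0 0 B) = char_poly A * char_poly B.
Proof.
rewrite /char_poly /char_poly_mx map_block_mx !raddf0 scalar_mx_block.
by rewrite opp_block_mx add_block_mx !oppr0 !addr0 det_ublock.
Qed.

Lemma char_poly_diag n (d : 'rV[F]_n) :
  char_poly (diag_mx d) = \prod_(x <- [seq d 0 i | i <- enum 'I_n]) ('X - x%:P).
Proof.
rewrite char_poly_trig ?diag_mx_is_trig // big_map -big_enum.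
by apply: eq_bigr => i _; rewrite mxE eqxx mulr1n.
Qed.

End CharPoly.

(** * Spectral sums and the equality case of Clarkson's inequality *)
Section Spectrum.
Variable C : numClosedFieldType.

Definition gram m n (A : 'M[C]_(m, n)) : 'M[C]_n := A^H *m A.

Definition spectrum n (H : 'M[C]_n) : seq C :=
  [seq spectral_diag H 0 i | i <- enum 'I_n].

Lemma size_spectrum n (H : 'M[C]_n) : size (spectrum H) = n.
Proof. by rewrite size_map size_enum_ord. Qed.

Lemma trmxCM m n p (A : 'M[C]_(m, n)) (B : 'M[C]_(n, p)) :
  (A *m B)^H = B^H *m A^H.
Proof. by rewrite trmx_mul map_mxM. Qed.

Lemma trmxCD m n (A B : 'M[C]_(m, n)) : (A + B)^H = A^H + B^H.
Proof. by rewrite !raddfD. Qed.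

Lemma trmxCN m n (A : 'M[C]_(m, n)) : (- A)^H = - A^H.
Proof. by rewrite !raddfN. Qed.

Lemma gram_normal m n (A : 'M[C]_(m, n)) : gram A \is normalmx.
Proof. by apply/normalmxP; rewrite /gram trmxCM trmxCK. Qed.

Lemma spectralmx_adjK n (H : 'M[C]_n) :
  (spectralmx H)^H *m spectralmx H = 1%:M.
Proof.
by have /unitarymxP := spectral_unitarymx H; move/mulmx1C.
Qed.

Lemma normal_diagonalized n (H : 'M[C]_n) : H \is normalmx ->
  spectralmx H *m H *m (spectralmx H)^H = diag_mx (spectral_diag H).
Proof.
move=> /orthomx_spectralP EH; rewrite [X in _ *m X *m _]EH.
have /unitarymxP UU := spectral_unitarymx H.
rewrite invmx_unitary ?spectral_unitarymx // !mulmxA UU mul1mx.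
by rewrite -mulmxA UU mulmx1.
Qed.

Lemma spectral_diag_gram0 m n (A : 'M[C]_(m, n)) :
  spectral_diag (gram A) = 0 -> gram A = 0.
Proof.
move=> d0; have := normal_diagonalized (gram_normal A).
have := spectralmx_adjK (gram A).
rewrite d0 raddf0; move: (gram A) => G; move: (spectralmx G) => S SS.
move=> /(congr1 (fun X => S^H *m X *m S)).
by rewrite mulmx0 mul0mx !mulmxA SS mul1mx -mulmxA SS mulmx1.
Qed.

Lemma char_poly_spectrum n (H : 'M[C]_n) : H \is normalmx ->
  char_poly H = \prod_(x <- spectrum H) ('X - x%:P).
Proof.
move=> nH; rewrite -char_poly_diag -normal_diagonalized //.
by rewrite char_poly_conj // spectralmx_adjK.
Qed.

(** The diagonal given by the spectral theorem is chosen arbitrarily; only the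
    multiset of its entries is determined, and this lemma reads it off from the
    characteristic polynomial. *)
Lemma spectrum_perm n (H : 'M[C]_n) (e : seq C) : H \is normalmx ->
  char_poly H = \prod_(x <- e) ('X - x%:P) -> perm_eq (spectrum H) e.
Proof. by move=> nH E; apply: prod_XsubC_eq; rewrite -char_poly_spectrum. Qed.

Lemma spectrum_adj m n (A : 'M[C]_(m, n)) :
  perm_eq (spectrum (gram A) ++ nseq m 0) (spectrum (gram A^H) ++ nseq n 0).
Proof.
apply: prod_XsubC_eq; rewrite !big_cat /= -!char_poly_spectrum ?gram_normal //.
rewrite !big_nseq !subr0 -!/(iterop _ _ _ _) !iter_mulr_1 /gram trmxCK.
exact: char_poly_mulC.
Qed.

Lemma gram_conj m n p (A : 'M[C]_(m, n)) (U : 'M[C]_(p, n)) :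
  U *m gram A *m U^H = gram (A *m U^H).
Proof. by rewrite /gram trmxCM trmxCK !mulmxA. Qed.

Lemma gram_diag_ge0 m n (A : 'M[C]_(m, n)) i : 0 <= gram A i i.
Proof.
by rewrite mxE sumr_ge0 // => j _; rewrite !mxE mulrC -normCK exprn_ge0.
Qed.

Lemma spectrum_gram_ge0 m n (A : 'M[C]_(m, n)) x :
  x \in spectrum (gram A) -> 0 <= x.
Proof.
case/mapP => i _ ->; have := gram_diag_ge0 (A *m (spectralmx (gram A))^H) i.
by rewrite -gram_conj normal_diagonalized ?gram_normal // mxE eqxx mulr1n.
Qed.

Lemma gram_row m n1 n2 (A : 'M[C]_(m, n1)) (B : 'M[C]_(m, n2)) :
  gram (row_mx A B) = block_mx (gram A) (A^H *m B) (B^H *m A) (gram B).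
Proof. by rewrite /gram tr_row_mx map_col_mx mul_col_row. Qed.

Lemma gram_col m1 m2 n (A : 'M[C]_(m1, n)) (B : 'M[C]_(m2, n)) :
  gram (col_mx A B) = gram A + gram B.
Proof. by rewrite /gram tr_col_mx map_row_mx mul_row_col. Qed.

(** The supporting line is asked for at positive points only: the graph of
    - x^q with 0 < q < 1 has a vertical tangent at 0. *)
Definition strictly_supported (phi : C -> C) :=
  forall a, 0 < a -> exists c, forall x, 0 <= x -> x != a ->
    phi a + c * (x - a) < phi x.

Definition specsum (phi : C -> C) m n (A : 'M[C]_(m, n)) : C :=
  \sum_(x <- spectrum (gram A)) phi x.

Lemma specsumE phi m n (A : 'M[C]_(m, n)) :
  specsum phi A = \sum_i phi (spectral_diag (gram A) 0 i).
Proof. by rewrite /specsum big_map big_enum. Qed.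

Section Convex.
Variable phi : C -> C.
Hypothesis phiP : strictly_supported phi.

(** A supporting line at the mean a settles the case a > 0.  When a = 0, every
    point of positive weight is 0 and there is equality. *)
Lemma jensen (I : finType) (w x : I -> C) (a := \sum_i w i * x i) :
  (forall i, 0 <= w i) -> \sum_i w i = 1 -> (forall i, 0 <= x i) ->
  phi a <= \sum_i w i * phi (x i) /\
  (phi a = \sum_i w i * phi (x i) -> forall i, w i != 0 -> x i = a).
Proof.
move=> w0 w1 x0.
have a0 : 0 <= a by apply: sumr_ge0 => i _; apply: mulr_ge0.
have [a_eq0 | a_neq0] := eqVneq a 0.
  have xw i : w i != 0 -> x i = a.
    move=> wi; move/eqP: (a_eq0); rewrite psumr_eq0 => [/allP/(_ i)|j _].
      by rewrite mem_index_enum mulf_eq0 (negPf wi) a_eq0 => /(_ isT)/eqP.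
    exact: mulr_ge0.
  suff -> : \sum_i w i * phi (x i) = phi a by [].
  rewrite -[phi a]mul1r -w1 mulr_suml; apply: eq_bigr => i _.
  by have [->|/xw ->] := eqVneq (w i) 0; rewrite ?mul0r.
have a_gt0 : 0 < a by rewrite lt_def a_neq0.
have [c phi_c] := phiP a_gt0.
have tangent : \sum_i w i * (phi a + c * (x i - a)) = phi a.
  under eq_bigr do rewrite mulrDr mulrCA mulrBr.
  rewrite big_split /= -mulr_suml w1 mul1r -mulr_sumr sumrB -mulr_suml w1 mul1r.
  by rewrite subrr mulr0 addr0.
have le_i i : w i * (phi a + c * (x i - a)) <= w i * phi (x i).
  apply: ler_wpM2l => //; have [->|/phi_c] := eqVneq (x i) a.
    by rewrite subrr mulr0 addr0.
  by move=> xa; rewrite ltW // xa.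
split; first by rewrite -[X in X <= _]tangent; apply: ler_sum.
move=> E i wi; apply/eqP/negP => /negP xi.
have : \sum_i w i * phi (x i) - \sum_i w i * (phi a + c * (x i - a)) == 0.
  by rewrite tangent E subrr.
rewrite -sumrB psumr_eq0 => [/allP/(_ i)|j _]; last by rewrite subr_ge0.
rewrite mem_index_enum -mulrBr mulf_eq0 (negPf wi) /= => /(_ isT).
by rewrite subr_eq0 gt_eqF // phi_c.
Qed.

(** The diagonal of U (A^H A) U^H is the image of the spectrum under the doubly
    stochastic matrix |W_ij|^2, where W is the change of basis from an eigenbasis
    to U.  Jensen's inequality on each row, summed with unit column sums, gives
    the bound.  Under equality W_ij can be nonzero only if the j-th eigenvalue is
    the i-th diagonal entry, so U itself diagonalizes. *)
Lemma peierls m n (A : 'M[C]_(m, n)) (U : 'M[C]_n) (D := U *m gram A *m U^H) :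
  U \is unitarymx ->
  \sum_i phi (D i i) <= specsum phi A /\
  (\sum_i phi (D i i) = specsum phi A -> is_diag_mx D).
Proof.
move=> Uu; pose W := U *m (spectralmx (gram A))^H.
pose l i := spectral_diag (gram A) 0 i.
have Wu : W \is unitarymx.
  by rewrite mul_unitarymx // trmxC_unitary spectral_unitarymx.
have WW : W *m W^H = 1%:M by exact/unitarymxP.
have DE i k : D i k = \sum_j W i j * (W k j)^* * l j.
  have -> : D = W *m diag_mx (spectral_diag (gram A)) *m W^H.
    rewrite -normal_diagonalized ?gram_normal // /W trmxCM trmxCK !mulmxA.
    rewrite -[U *m _ *m _]mulmxA spectralmx_adjK mulmx1.
    rewrite -[_ *m _ *m spectralmx _]mulmxA spectralmx_adjK mulmx1.
    by rewrite /D /gram !mulmxA.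
  rewrite mul_mx_diag mxE; apply: eq_bigr => j _.
  by rewrite !mxE mulrAC.
move: W D Wu WW DE => W D Wu WW DE.
pose w i j := W i j * (W i j)^*.
have w0 i j : 0 <= w i j by rewrite /w -normCK exprn_ge0.
have wr i : \sum_j w i j = 1.
  move/matrixP/(_ i i): WW; rewrite !mxE eqxx mulr1n => <-.
  by apply: eq_bigr => j _; rewrite !mxE.
have wc j : \sum_i w i j = 1.
  move/mulmx1C/matrixP/(_ j j): WW; rewrite !mxE eqxx mulr1n => <-.
  by apply: eq_bigr => i _; rewrite !mxE mulrC.
have l0 j : 0 <= l j by apply: (@spectrum_gram_ge0 _ _ A); rewrite map_f ?mem_enum.
have J i := jensen (w0 i) (wr i) l0.
have sumE : specsum phi A = \sum_i \sum_j w i j * phi (l j).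
  rewrite specsumE exchange_big /=; apply: eq_bigr => j _.
  by rewrite -mulr_suml wc mul1r.
split; first by rewrite sumE ler_sum // => i _; rewrite DE; case: (J i).
move=> /eqP; rewrite sumE eq_sym -subr_eq0 -sumrB psumr_eq0 => [/allP E|i _]; last first.
  by rewrite subr_ge0 DE; case: (J i).
apply/is_diag_mxP => i k ik.
have El j : W i j != 0 -> l j = D i i.
  move=> Wij; have := E i; rewrite mem_index_enum subr_eq0 => /(_ isT)/eqP/esym.
  rewrite DE; case: (J i) => _ /[apply] /(_ j); apply.
  by rewrite mulf_neq0 // conjC_eq0.
have -> : D i k = \sum_j W i j * W^H j k * D i i.
  rewrite DE; apply: eq_bigr => j _; rewrite !mxE.
  by have [->|/El ->] := eqVneq (W i j) 0; rewrite ?mul0r.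
rewrite -mulr_suml; move/matrixP/(_ i k): WW; rewrite mxE => ->.
by rewrite mxE -val_eqE (negPf ik) mul0r.
Qed.

Lemma specsum_diag m n (A : 'M[C]_(m, n)) (U : 'M[C]_n) d :
  U \is unitarymx -> U *m gram A *m U^H = diag_mx d ->
  specsum phi A = \sum_i phi (d 0 i).
Proof.
move=> Uu E; rewrite -big_enum -(big_map (d 0) xpredT phi).
apply: perm_big; apply: spectrum_perm; rewrite ?gram_normal //.
by rewrite -char_poly_diag -E char_poly_conj //; apply/mulmx1C/unitarymxP.
Qed.

(** Conjugating the Gram matrix of (A B) by eigenbases of its diagonal blocks
    puts the two spectra on the diagonal and leaves the off-diagonal block
    equivalent to A^H B; Peierls' theorem and its equality case do the rest. *)
Lemma specsum_row m n1 n2 (A : 'M[C]_(m, n1)) (B : 'M[C]_(m, n2)) :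
  specsum phi A + specsum phi B <= specsum phi (row_mx A B) /\
  (specsum phi A + specsum phi B = specsum phi (row_mx A B) <-> A^H *m B = 0).
Proof.
pose SA := spectralmx (gram A); pose SB := spectralmx (gram B).
pose U := block_mx SA 0 0 SB.
have UH : U^H = block_mx SA^H 0 0 SB^H.
  by rewrite /U tr_block_mx map_block_mx !trmx0 !map_mx0.
have SAu := spectral_unitarymx (gram A); have SBu := spectral_unitarymx (gram B).
have Uu : U \is unitarymx.
  apply/unitarymxP; rewrite UH mulmx_block !mulmx0 !mul0mx !addr0 !add0r.
  by rewrite !(unitarymxP _) // -scalar_mx_block.
have DE : U *m gram (row_mx A B) *m U^H =
    block_mx (diag_mx (spectral_diag (gram A))) (SA *m (A^H *m B) *m SB^H)
             (SB *m (B^H *m A) *m SA^H) (diag_mx (spectral_diag (gram B))).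
  rewrite gram_row UH !mulmx_block !mulmx0 !mul0mx !addr0 !add0r.
  by rewrite !normal_diagonalized ?gram_normal.
have sumE : \sum_i phi ((U *m gram (row_mx A B) *m U^H) i i) =
    specsum phi A + specsum phi B.
  rewrite big_split_ord /= DE !specsumE /=.
  by congr (_ + _); apply: eq_bigr => i _;
    rewrite ?block_mxEul ?block_mxEdr mxE eqxx mulr1n.
have [le_row eq_row] := peierls (row_mx A B) Uu.
rewrite sumE in le_row eq_row; split=> //; split=> [/eq_row|AB].
  rewrite DE => /is_diag_mxP D0; have {D0} : SA *m (A^H *m B) *m SB^H = 0.
    apply/matrixP => i j; have := D0 (lshift n2 i) (rshift n1 j).
    rewrite block_mxEur [X in _ -> _ = X]mxE; apply.
    by rewrite /= neq_ltn ltn_addr.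
  move/(congr1 (fun X => SA^H *m X *m SB)); rewrite mulmx0 mul0mx !mulmxA.
  rewrite spectralmx_adjK mul1mx -!mulmxA spectralmx_adjK mulmx1.
  by [].
have BA : B^H *m A = 0.
  by rewrite -[A]trmxCK -trmxCM AB trmx0 map_mx0.
have D0 : U *m gram (row_mx A B) *m U^H =
    diag_mx (row_mx (spectral_diag (gram A)) (spectral_diag (gram B))).
  by rewrite DE AB BA !mulmx0 !mul0mx diag_mx_row.
rewrite (specsum_diag Uu D0) -sumE; apply: eq_bigr => i _.
by rewrite D0 mxE eqxx mulr1n.
Qed.

Hypothesis phi0 : phi 0 = 0.

Lemma specsum_adj m n (A : 'M[C]_(m, n)) : specsum phi A^H = specsum phi A.
Proof.
have : \sum_(x <- spectrum (gram A) ++ nseq m 0) phi x =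
    \sum_(x <- spectrum (gram A^H) ++ nseq n 0) phi x.
  by apply: perm_big; apply: spectrum_adj.
rewrite !big_cat !big_nseq /=.
by rewrite phi0 !iter_addr_0 !mul0rn !addr0 /specsum => ->.
Qed.

Lemma midpoint x y : 0 <= x -> 0 <= y -> phi ((x + y) / 2) *+ 2 <= phi x + phi y.
Proof.
move=> x0 y0.
have [|||+ _] := @jensen bool (fun=> 2^-1) (fun b : bool => if b then x else y).
- by move=> _; rewrite invr_ge0 ler0n.
- by rewrite big_bool /= -mulr2n -[2^-1 *+ 2]mulr_natr mulVf // pnatr_eq0.
- by case.
rewrite !big_bool /= -!mulrDr mulrC [X in _ <= X]mulrC => H.
by rewrite -[_ *+ 2]mulr_natr -ler_pdivlMr // ltr0n.
Qed.

(** Since (A + B)^H (A + B) + (A - B)^H (A - B) is twice the Gram matrix of the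
    column (A; B), each eigenvalue of the latter is the mean of two diagonal
    entries of the former matrices in the same basis. *)
Lemma clarkson_col m n (A B : 'M[C]_(m, n)) :
  specsum phi (col_mx A B) *+ 2 <= specsum phi (A + B) + specsum phi (A - B).
Proof.
pose U := spectralmx (gram (col_mx A B)).
have Uu : U \is unitarymx by apply: spectral_unitarymx.
have D := normal_diagonalized (gram_normal (col_mx A B)).
rewrite (specsum_diag Uu D).
have [le1 _] := peierls (A + B) Uu; have [le2 _] := peierls (A - B) Uu.
apply: le_trans (lerD le1 le2); rewrite -big_split /= -sumrMnl.
apply: ler_sum => i _.
set x := (_ *m gram (A + B) *m _) i i; set y := (_ *m gram (A - B) *m _) i i.
have -> : spectral_diag (gram (col_mx A B)) 0 i = (x + y) / 2.
  have <- : (U *m gram (col_mx A B) *m U^H) i i = spectral_diag (gram (col_mx A B)) 0 i.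
    by rewrite D mxE eqxx mulr1n.
  apply: (canRL (mulfK _)); first by rewrite pnatr_eq0.
  rewrite /x /y mulr_natr mulr2n -/U.
  have addE X Y : (U *m X *m U^H) i i + (U *m Y *m U^H) i i
      = (U *m (X + Y) *m U^H) i i by rewrite mulmxDr mulmxDl [RHS]mxE.
  rewrite !addE; congr ((_ *m _ *m _) _ _).
  have <- : gram (A + B) + gram (A - B) = gram (col_mx A B) + gram (col_mx A B).
    rewrite gram_col /gram !raddfD !raddfN /= ?mulmxDl ?mulNmx ?opprK.
    rewrite ?mulmxDl ?mulNmx ?opprK.
    move: (A^H *m A) (A^H *m B) (B^H *m A) (B^H *m B) => P Q R T.
    by apply/matrixP => ? ?; rewrite !mxE; ring.
  by [].
by apply: midpoint; rewrite /x /y gram_conj gram_diag_ge0.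
Qed.

Lemma clarkson m n (A B : 'M[C]_(m, n)) :
  (specsum phi A + specsum phi B) *+ 2 <= specsum phi (A + B) + specsum phi (A - B) /\
  ((specsum phi A + specsum phi B) *+ 2 = specsum phi (A + B) + specsum phi (A - B) ->
    A *m B^H = 0).
Proof.
have [le_row eq_row] := specsum_row A^H B^H.
have colE : specsum phi (col_mx A B) = specsum phi (row_mx A^H B^H).
  by rewrite -specsum_adj tr_col_mx map_row_mx.
have le_col := clarkson_col A B.
rewrite !specsum_adj -colE in le_row eq_row.
split; first by apply: le_trans le_col; rewrite ler_pMn2r.
move=> E; rewrite -[A]trmxCK; apply/eq_row/le_anti/andP; split=> //.
by rewrite -(@ler_pMn2r _ 2) // E.
Qed.

Lemma clarkson_eq m n (A B : 'M[C]_(m, n)) :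
  (specsum phi A + specsum phi B) *+ 2 = specsum phi (A + B) + specsum phi (A - B) ->
  A^H *m B = 0 /\ A *m B^H = 0.
Proof.
move=> E; split; last by have [_] := clarkson A B; apply.
rewrite -[B]trmxCK; have [_] := clarkson A^H B^H; apply.
by rewrite -trmxCN -!trmxCD !specsum_adj.
Qed.

(** When A^H B = 0 the matrix A + B and the column (A; B) have the same Gram
    matrix, and when A B^H = 0 the adjoint row has block-diagonal Gram matrix. *)
Lemma specsum_disjointD m n (A B : 'M[C]_(m, n)) :
  A^H *m B = 0 -> A *m B^H = 0 ->
  specsum phi (A + B) = specsum phi A + specsum phi B.
Proof.
move=> AB BA; have [_ [_]] := specsum_row A^H B^H.
rewrite trmxCK => /(_ BA); rewrite !specsum_adj => ->.
rewrite -[in RHS]specsum_adj tr_row_mx map_col_mx !trmxCK.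
have BA' : B^H *m A = 0 by rewrite -[A]trmxCK -trmxCM AB trmx0 map_mx0.
by rewrite /specsum gram_col /gram trmxCD mulmxDl !mulmxDr AB BA' add0r addr0.
Qed.

Lemma specsum_disjointB m n (A B : 'M[C]_(m, n)) :
  A^H *m B = 0 -> A *m B^H = 0 ->
  specsum phi (A - B) = specsum phi A + specsum phi B.
Proof.
move=> AB BA; rewrite specsum_disjointD.
- by congr (_ + _); rewrite /specsum /gram trmxCN mulNmx mulmxN opprK.
- by rewrite mulmxN AB oppr0.
- by rewrite trmxCN mulmxN BA oppr0.
Qed.

End Convex.
End Spectrum.

(** * Invariance of spectral sums *)
Section SpecsumInvariance.
Variables (C : numClosedFieldType) (phi : C -> C).

Lemma specsum_char_poly m1 m2 n (A : 'M[C]_(m1, n)) (B : 'M[C]_(m2, n)) :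
  char_poly (gram A) = char_poly (gram B) -> specsum phi A = specsum phi B.
Proof.
move=> E; apply: perm_big; apply: spectrum_perm; rewrite ?gram_normal //.
by rewrite E char_poly_spectrum ?gram_normal.
Qed.

Lemma specsum_unitary m n (U : 'M[C]_m) (A : 'M[C]_(m, n)) (V : 'M[C]_n) :
  U \is unitarymx -> V \is unitarymx -> specsum phi (U *m A *m V) = specsum phi A.
Proof.
move=> /unitarymxP/mulmx1C UU /unitarymxP VV; apply: specsum_char_poly.
have -> : gram (U *m A *m V) = V^H *m gram A *m V.
  by rewrite /gram !trmxCM -!mulmxA (mulmxA U^H) UU mul1mx.
exact: char_poly_conj.
Qed.

Lemma specsum_block m1 m2 n1 n2 (A : 'M[C]_(m1, n1)) (B : 'M[C]_(m2, n2)) :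
  specsum phi (block_mx A 0 0 B) = specsum phi A + specsum phi B.
Proof.
rewrite /specsum -big_cat /=; apply: perm_big.
apply: spectrum_perm; rewrite ?gram_normal //.
rewrite big_cat /= -!char_poly_spectrum ?gram_normal //.
rewrite -char_poly_block /gram tr_block_mx map_block_mx !trmx0 !map_mx0.
by rewrite mulmx_block !mulmx0 !mul0mx !addr0 !add0r.
Qed.

Lemma specsum_tens m1 m2 n1 n2 (A : 'M[C]_(m1, n1)) (B : 'M[C]_(m2, n2)) :
  (forall x y, 0 <= x -> 0 <= y -> phi (x * y) = phi x * phi y) ->
  specsum phi (A *t B) = specsum phi A * specsum phi B.
Proof.
move=> phiM; pose SA := spectralmx (gram A); pose SB := spectralmx (gram B).
have SAu := spectral_unitarymx (gram A); have SBu := spectral_unitarymx (gram B).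
have tensH m n m' n' (X : 'M[C]_(m, n)) (Y : 'M[C]_(m', n')) :
  (X *t Y)^H = X^H *t Y^H by rewrite trmx_tens map_mxT.
have Uu : SA *t SB \is unitarymx.
  apply/unitarymxP; rewrite tensH tensmx_mul !(unitarymxP _) //.
  apply/matrixP => i j; rewrite !mxE -natrM mulnb -xpair_eqE -!surjective_pairing.
  by rewrite (can_eq (@mxtens_unindexK _ _)).
have gramT : gram (A *t B) = gram A *t gram B by rewrite /gram tensH tensmx_mul.
pose dA := spectral_diag (gram A); pose dB := spectral_diag (gram B).
have DE : (SA *t SB) *m gram (A *t B) *m (SA *t SB)^H =
   diag_mx (\row_k (dA 0 (mxtens_unindex k).1 * dB 0 (mxtens_unindex k).2)).
  rewrite gramT tensH !tensmx_mul !normal_diagonalized ?gram_normal //.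
  apply/matrixP => i j; rewrite !mxE -[in RHS](can_eq (@mxtens_unindexK _ _)).
  case: (mxtens_unindex i) (mxtens_unindex j) => i1 i2 [j1 j2] /=.
  by rewrite xpair_eqE; do 2!case: eqVneq => [->|_]; rewrite ?mul0r ?mulr0.
rewrite (specsum_diag phi Uu DE) !specsumE mulr_sum; apply: eq_bigr => k _.
have l0 m n (X : 'M[C]_(m, n)) i : 0 <= spectral_diag (gram X) 0 i.
  by apply: (@spectrum_gram_ge0 _ _ _ X); rewrite map_f ?mem_enum.
by rewrite mxE phiM //; apply: l0.
Qed.

Hypothesis phi0 : phi 0 = 0.

Lemma specsum_tr m n (A : 'M[C]_(m, n)) : specsum phi A^T = specsum phi A.
Proof.
rewrite -[in RHS]specsum_adj //; apply: specsum_char_poly.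
by rewrite -char_poly_tr /gram trmxCK trmx_mul !trmxK map_trmx.
Qed.

Lemma specsum0 m n : specsum phi (0 : 'M_(m, n)) = 0.
Proof.
rewrite (@specsum_diag _ phi _ _ _ 1%:M 0).
- by apply: big1 => i _; rewrite mxE.
- by apply/unitarymxP; rewrite trmx1 map_mx1 mulmx1.
- by rewrite /gram mulmx0 mulmx0 mul0mx raddf0.
Qed.

End SpecsumInvariance.

(** * Strict convexity of powers *)
Section PowerFunction.
Variable R : realType.
Local Notation C := R[i].

(** With t = exp x and y = q x, combine exp x > exp y (1 + (x - y)) and
    1 >= exp y (1 - y) with weights q and 1 - q; the right-hand sides add up to
    exp y = t^q. *)
Lemma bernoulli_lt1 (q t : R) : 0 < q < 1 -> 0 <= t -> t != 1 ->
  t `^ q < 1 + q * (t - 1).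
Proof.
move=> /andP[q0 q1] t0 t1; have [->|tn0] := eqVneq t 0.
  by rewrite powR0 ?gt_eqF // sub0r mulrN1 subr_gt0.
have tp : 0 < t by rewrite lt_def tn0.
pose x := ln t; have tE : t = expR x by rewrite lnK.
have x0 : x != 0 by apply: contraNneq t1; rewrite tE => ->; rewrite expR0.
have -> : t `^ q = expR (q * x) by rewrite /powR (negPf tn0).
set y := q * x; have ey : 0 < expR y := expR_gt0 y.
have xy : x - y != 0.
  by rewrite /y -{1}[x]mul1r -mulrBl mulf_neq0 // subr_eq0 gt_eqF.
have T1 : expR y * (1 + (x - y)) < t.
  have E : expR x = expR y * expR (x - y) by rewrite -expRD subrKC.
  by rewrite tE E ltr_pM2l // expR_gt1Dx.
have T2 : expR y * (1 + (- y)) <= 1.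
  have E : expR y * expR (- y) = 1 by rewrite -expRD subrr expR0.
  by rewrite -[X in _ <= X]E ler_pM2l // expR_ge1Dx.
move: T1 T2; rewrite /y; set e := expR _ => T1 T2; nra.
Qed.

(** The inequality for the exponent q^-1 at the point s = 1 + q (t - 1), raised to
    the power q. *)
Lemma bernoulli_gt1 (q t : R) : 1 < q -> 0 <= t -> t != 1 ->
  1 + q * (t - 1) < t `^ q.
Proof.
move=> q1 t0 t1; have q0 : 0 < q by lra.
have [s0|s0] := ltP 0 (1 + q * (t - 1)); last first.
  have [t00|tn0] := eqVneq t 0; first by move: s0; rewrite t00 powR0 ?gt_eqF //; lra.
  by apply: le_lt_trans s0 _; rewrite powR_gt0 // lt_def tn0.
set s := 1 + _ in s0 *.
have s1 : s != 1.
  by rewrite /s -subr_eq0 addrC addKr; apply: mulf_neq0; rewrite ?subr_eq0 // gt_eqF.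
have := @bernoulli_lt1 q^-1 s; rewrite invr_gt0 q0 invf_lt1 // q1 => /(_ isT (ltW s0) s1).
have -> : 1 + q^-1 * (s - 1) = t.
  by rewrite /s [X in _ * X]addrC addKr mulKf ?gt_eqF // addrC subrK.
move=> H; rewrite -[s](powRr1 (ltW s0)) -[X in _ `^ X < _](mulVf (lt0r_neq0 q0)) powRrM.
by rewrite gt0_ltr_powR // ?nnegrE ?powR_ge0.
Qed.

(** Eigenvalues live in the complex field, hence so does the power function; it
    is meant for nonnegative arguments, where taking the real part is harmless. *)
Definition pow_re (q : R) (x : C) : C := ((complex.Re x) `^ q)%:C%C.

Lemma ge0_ReK (x : C) : 0 <= x -> (complex.Re x)%:C%C = x.
Proof. by move=> x0; rewrite RRe_real // ger0_real. Qed.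

Lemma pow_reM q x y : 0 <= x -> 0 <= y ->
  pow_re q (x * y) = pow_re q x * pow_re q y.
Proof.
move=> x0 y0; rewrite /pow_re -(ge0_ReK x0) -(ge0_ReK y0) -!rmorphM /=.
by rewrite powRM // -lecR ge0_ReK.
Qed.

Lemma pow_re0 q : 0 < q -> pow_re q 0 = 0.
Proof. by move=> q0; rewrite /pow_re powR0 ?gt_eqF. Qed.

Lemma tangent_scaled (q a x : R) : 0 < a -> 0 <= x ->
  a `^ q + q * a `^ q / a * (x - a) = a `^ q * (1 + q * (x / a - 1)) /\
  x `^ q = a `^ q * (x / a) `^ q.
Proof.
move=> a0 x0; split; last first.
  rewrite -powRM ?(ltW a0) //; last by rewrite divr_ge0 // ltW.
  by rewrite mulrC divfK ?gt_eqF.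
by field; rewrite gt_eqF.
Qed.

Lemma pow_re_supported q : 1 < q -> strictly_supported (pow_re q).
Proof.
move=> q1 a a_gt0; have aE := ge0_ReK (ltW a_gt0).
move: a_gt0; rewrite -aE ltcR; move: (complex.Re a) => {a aE} a a_gt0.
exists (q * a `^ q / a)%:C%C => x x0; have xE := ge0_ReK x0.
move: x0; rewrite -xE lecR; move: (complex.Re x) => {x xE} x x0 xa.
rewrite /pow_re /= -rmorphB -rmorphM -rmorphD ltcR /=.
have [-> ->] := tangent_scaled q a_gt0 x0.
rewrite ltr_pM2l ?powR_gt0 // bernoulli_gt1 // ?divr_ge0 ?(ltW a_gt0) //.
apply: contra xa => /eqP E; rewrite -[x](divfK (lt0r_neq0 a_gt0)) E mul1r.
exact: eqxx.
Qed.

Lemma opp_pow_re_supported q : 0 < q < 1 -> strictly_supported (fun x => - pow_re q x).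
Proof.
move=> q01 a a_gt0; have aE := ge0_ReK (ltW a_gt0).
move: a_gt0; rewrite -aE ltcR; move: (complex.Re a) => {a aE} a a_gt0.
exists (- (q * a `^ q / a)%:C%C) => x x0; have xE := ge0_ReK x0.
move: x0; rewrite -xE lecR; move: (complex.Re x) => {x xE} x x0 xa.
rewrite mulNr -opprD ltrN2 /pow_re /= -rmorphB -rmorphM -rmorphD ltcR /=.
have [-> ->] := tangent_scaled q a_gt0 x0.
rewrite ltr_pM2l ?powR_gt0 // bernoulli_lt1 // ?divr_ge0 ?(ltW a_gt0) //.
apply: contra xa => /eqP E; rewrite -[x](divfK (lt0r_neq0 a_gt0)) E mul1r.
exact: eqxx.
Qed.

End PowerFunction.

(** * The Schatten functional as a spectral sum *)
Section Scalars.
Variables (R : realType) (k : scalar_kind).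
Local Notation F := (scalar_field R k).
Local Notation C := R[i].
Local Notation conjF := (@conj_scalar R k).
Local Notation toC := (@to_complex R k).

Lemma conj_scalar_zmod : zmod_morphism (@conj_scalar R k).
Proof. by case: k => x y //=; rewrite rmorphB. Qed.
Lemma conj_scalar_monoid : monoid_morphism (@conj_scalar R k).
Proof. by case: k; split=> // [|x y] /=; rewrite ?rmorph1 ?rmorphM. Qed.
HB.instance Definition _ :=
  GRing.isZmodMorphism.Build _ _ (@conj_scalar R k) conj_scalar_zmod.
HB.instance Definition _ :=
  GRing.isMonoidMorphism.Build _ _ (@conj_scalar R k) conj_scalar_monoid.

Lemma to_complex_zmod : zmod_morphism (@to_complex R k).
Proof. by case: k => x y //=; rewrite rmorphB. Qed.
Lemma to_complex_monoid : monoid_morphism (@to_complex R k).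
Proof. by case: k; split=> // x y /=; rewrite rmorphM. Qed.
HB.instance Definition _ :=
  GRing.isZmodMorphism.Build _ _ (@to_complex R k) to_complex_zmod.
HB.instance Definition _ :=
  GRing.isMonoidMorphism.Build _ _ (@to_complex R k) to_complex_monoid.

Lemma conj_scalarK : involutive conjF.
Proof. by case: k => x //=; rewrite conjCK. Qed.

Lemma to_complex_conj x :
  toC (conjF x) = (toC x)^* :> C.
Proof. by case: k x => x //=; apply/esym/CrealP; rewrite complex_real. Qed.

Lemma mul_conj_ge0 (x : F) : 0 <= conjF x * x.
Proof.
case: k x => x /=; first by rewrite -expr2 sqr_ge0.
by rewrite mulrC -normCK exprn_ge0.
Qed.

Lemma mul_conj_eq0 (x : F) : (conjF x * x == 0) = (x == 0).
Proof. by rewrite mulf_eq0 fmorph_eq0 orbb. Qed.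

Lemma to_complex_gt0 (x : F) : (0 < toC x) = (0 < x).
Proof. by case: k x => x //=; rewrite ltcR. Qed.

Lemma gt0_to_complex (z : C) : 0 < z -> exists2 x : F, 0 < x & toC x = z.
Proof.
move=> z0; suff [x xz] : exists x : F, toC x = z.
  by exists x => //; rewrite -to_complex_gt0 xz.
case: k; last by exists z.
by exists (complex.Re z); rewrite /= ge0_ReK // ltW.
Qed.

Lemma gt0_conj (x : F) : 0 < x -> conjF x = x.
Proof. by case: k x => x //= x0; apply/CrealP/gtr0_real. Qed.

Lemma gt0_sqrt (x : F) : 0 < x -> exists2 y : F, 0 < y & y * y = x.
Proof.
case: k x => x /= x0.
  by exists (Num.sqrt x); rewrite ?sqrtr_gt0 // -expr2 sqr_sqrtr // ltW.
by exists (sqrtC x); rewrite ?sqrtC_gt0 // -expr2 sqrtCK.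
Qed.

Local Notation "A ^emb" := (map_mx toC A) (at level 8, format "A ^emb").

Lemma map_adjmx m n (A : 'M[F]_(m, n)) : (adjmx A)^emb = (A^emb)^H.
Proof. by apply/matrixP => i j; rewrite !mxE to_complex_conj. Qed.

Lemma gram_complex m n (A : 'M[F]_(m, n)) : (adjmx A *m A)^emb = gram A^emb.
Proof. by rewrite map_mxM map_adjmx. Qed.

Lemma map_complex_eq0 m n (A : 'M[F]_(m, n)) : A^emb = 0 -> A = 0.
Proof. by move=> /eqP; rewrite map_mx_eq0 => /eqP. Qed.

(** A nonzero entry beyond position m would make the m entries before it nonzero
    as well. *)
Lemma sorted_drop0 (T : realDomainType) (L : seq T) m : sorted >=%R L ->
  {in L, forall x, 0 <= x} -> (count (predC1 0%R) L <= m)%N ->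
  {in drop m L, forall x, x = 0}.
Proof.
move=> srt pos cnt x xd; apply/eqP/negPn/negP => x0.
have mL : (m < size L)%N.
  by rewrite ltnNge; apply: contraL xd => le; rewrite drop_oversize.
have allp : all (predC1 0) (take m L).
  move: srt; rewrite sorted_pairwise; last by move=> ? ? ? /[swap]; apply: le_trans.
  rewrite -{1}(cat_take_drop m L) pairwise_cat => /and3P[/allrelP H _ _].
  apply/allP => y yt; rewrite /= gt_eqF //; apply: lt_le_trans (H _ _ yt xd).
  by rewrite lt_def x0 pos // (mem_drop xd).
move: cnt; rewrite -{1}(cat_take_drop m L) count_cat leqNgt => /negP; apply.
move: allp; rewrite all_count => /eqP ->; rewrite size_take mL -[X in (X < _)%N]addn0.
by rewrite ltn_add2l -has_count; apply/hasP; exists x.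
Qed.

Section Schatten.
Variable p : R.
Hypothesis p0 : 0 < p.

(** Truncating the sorted list to min(m, n) entries only drops zeros: the nonzero
    eigenvalues of A^H A are those of A A^H, so there are at most min(m, n) of
    them. *)
Lemma sum_singular_values m n (A : 'M[F]_(m, n)) :
  (\sum_(s <- singular_values A) s `^ p)%:C%C = specsum (pow_re (p / 2)) A^emb.
Proof.
rewrite /singular_values gram_complex.
set L := sort _ _; pose f (x : C) := Num.sqrt (complex.Re x).
have pL : perm_eq L (map f (spectrum (gram A^emb))).
  by rewrite /L perm_sort -(map_comp f).
have LE : \sum_(s <- take (minn m n) L) s `^ p = \sum_(s <- L) s `^ p.
  rewrite -[in RHS](cat_take_drop (minn m n) L) big_cat /=.
  rewrite [X in _ + X]big_seq [X in _ + X]big1 ?addr0 // => s sd.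
  suff -> : s = 0 by rewrite powR0 ?gt_eqF.
  apply: sorted_drop0 sd.
  - by apply: sort_sorted => x y; apply: le_total.
  - by move=> x; rewrite (perm_mem pL) => /mapP[y _ ->]; rewrite sqrtr_ge0.
  have /permP -> := pL; rewrite count_map.
  have -> : count (preim f (predC1 0%R)) (spectrum (gram A^emb)) =
            count (predC1 0%R) (spectrum (gram A^emb)).
    apply: eq_in_count => x /spectrum_gram_ge0 x0 /=; rewrite /f sqrtr_eq0.
    move: (x0); rewrite -(ge0_ReK x0) lecR /=; move: (complex.Re x) => y y0.
    by rewrite eq_complex /= eqxx andbT -ltNge lt_def y0 andbT.
  rewrite leq_min; apply/andP; split; last first.
    by rewrite -[X in (_ <= X)%N](size_spectrum (gram A^emb)) count_size.
  have /permP/(_ (predC1 0%R)) := spectrum_adj A^emb.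
  rewrite !count_cat !count_nseq /= eqxx !mul0n !addn0 => ->.
  by rewrite -[X in (_ <= X)%N](size_spectrum (gram A^emb^H)) count_size.
rewrite LE (perm_big _ pL) big_map rmorph_sum /specsum; apply: eq_big_seq => x.
move=> /spectrum_gram_ge0 x0; rewrite /pow_re /f -powR12_sqrt.
  by rewrite -powRrM mulrC.
by rewrite -lecR ge0_ReK.
Qed.

Lemma schatten_ge0 m n (A : 'M[F]_(m, n)) : 0 <= schatten p A.
Proof. exact: powR_ge0. Qed.

Lemma schatten_specsum m n (A : 'M[F]_(m, n)) :
  (schatten p A `^ p)%:C%C = specsum (pow_re (p / 2)) A^emb.
Proof.
rewrite -sum_singular_values /schatten -powRrM mulVf ?gt_eqF // powRr1 //.
by apply: sumr_ge0 => s _; apply: powR_ge0.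
Qed.

End Schatten.

Definition disjoint_mx m n (A B : 'M[F]_(m, n)) :=
  adjmx A *m B = 0 /\ A *m adjmx B = 0.

Definition disjointness_preserver m n r s (Phi : 'M[F]_(m, n) -> 'M[F]_(r, s)) :=
  forall A B, (\rank A <= 1)%N -> (\rank B <= 1)%N -> disjoint_mx A B ->
    disjoint_mx (Phi A) (Phi B).

Lemma disjoint_complex m n (A B : 'M[F]_(m, n)) :
  disjoint_mx A B <-> (A^emb)^H *m B^emb = 0 /\ A^emb *m (B^emb)^H = 0.
Proof.
rewrite -!map_adjmx -!map_mxM; split=> [[-> ->]|[]].
  by rewrite !map_mx0.
by move=> /map_complex_eq0 ? /map_complex_eq0.
Qed.

(** A disjoint pair of matrices of rank at most 1 is an equality case of
    Clarkson's inequality that only involves matrices of rank at most 2, and Phi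
    preserves every term of the equality. *)
Lemma schatten_preserver_disjoint (p : R) (hp : 0 < p < 2 \/ 2 < p) m n r s
   (Phi : {linear 'M[F]_(m, n) -> 'M[F]_(r, s)}) :
  (forall A, (\rank A <= 2)%N -> schatten p (Phi A) = schatten p A) ->
  disjointness_preserver Phi.
Proof.
move=> PhiP A B rA rB /disjoint_complex[AB BA].
have p0 : 0 < p by case: hp => [/andP[]//|]; lra.
have [phi [phiS phi0 phiE]] : exists phi : C -> C,
    [/\ strictly_supported phi, phi 0 = 0 &
        forall X Y : 'M[F]_(m, n), schatten p (Phi X) = schatten p Y ->
          specsum phi (Phi X)^emb = specsum phi Y^emb].
  have powE (X Y : 'M[F]_(m, n)) : schatten p (Phi X) = schatten p Y ->
      specsum (pow_re (p / 2)) (Phi X)^emb = specsum (pow_re (p / 2)) Y^emb.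
    by move=> E; rewrite -(schatten_specsum p0 (Phi X)) -(schatten_specsum p0 Y) E.
  have po0 : pow_re (p / 2) 0 = 0 :> C by apply: pow_re0; rewrite divr_gt0.
  case: hp => hp.
    exists (fun x => - pow_re (p / 2) x); split.
    - apply: opp_pow_re_supported; lra.
    - by rewrite po0 oppr0.
    - by move=> X Y /powE; rewrite /specsum !sumrN => ->.
  exists (pow_re (p / 2)); split=> //.
  by apply: pow_re_supported; lra.
have rD (X Y : 'M[F]_(m, n)) :
    (\rank X <= 1)%N -> (\rank Y <= 1)%N -> (\rank (X + Y)%R <= 2)%N.
  by move=> rX rY; apply: leq_trans (mxrank_add _ _) _; apply: (leq_add rX rY).
apply/disjoint_complex; apply: (clarkson_eq phiS phi0).
rewrite -map_mxD -map_mxB -linearD -linearB.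
have r1 (X : 'M[F]_(m, n)) : (\rank X <= 1)%N -> (\rank X <= 2)%N.
  by move=> /leq_trans; apply.
have rB' :  (\rank (- B)%R <= 1)%N by rewrite mxrank_opp.
rewrite (phiE _ _ (PhiP _ (r1 _ rA))) (phiE _ _ (PhiP _ (r1 _ rB))).
rewrite (phiE _ _ (PhiP _ (rD _ _ rA rB))) (phiE _ _ (PhiP _ (rD _ _ rA rB'))).
rewrite map_mxD map_mxB (specsum_disjointD phiS phi0) // (specsum_disjointB phiS phi0) //.
Qed.

End Scalars.

(** * Adjoints and eigenvectors over the scalar field *)
Section Adjoint.
Variables (R : realType) (k : scalar_kind).
Local Notation F := (scalar_field R k).
Local Notation C := R[i].
Local Notation conjF := (@conj_scalar R k).
Local Notation toC := (@to_complex R k).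
Local Notation "A ^emb" := (map_mx toC A) (at level 8, format "A ^emb").

Lemma adjmxK m n (A : 'M[F]_(m, n)) : A^h^h = A.
Proof. by apply/matrixP => i j; rewrite !mxE conj_scalarK. Qed.

Lemma adjmxM m n p (A : 'M[F]_(m, n)) (B : 'M[F]_(n, p)) :
  (A *m B)^h = B^h *m A^h.
Proof. by rewrite /adjmx map_mxM trmx_mul. Qed.

Lemma adjmxD m n (A B : 'M[F]_(m, n)) : (A + B)^h = A^h + B^h.
Proof. by rewrite /adjmx map_mxD linearD. Qed.

Lemma adjmxN m n (A : 'M[F]_(m, n)) : (- A)^h = - A^h.
Proof. by rewrite /adjmx map_mxN linearN. Qed.

Lemma adjmxB m n (A B : 'M[F]_(m, n)) : (A - B)^h = A^h - B^h.
Proof. by rewrite adjmxD adjmxN. Qed.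

Lemma adjmxZ m n a (A : 'M[F]_(m, n)) : (a *: A)^h = conjF a *: A^h.
Proof. by rewrite /adjmx map_mxZ linearZ. Qed.

Lemma adjmx0 m n : (0 : 'M[F]_(m, n))^h = 0.
Proof. by rewrite /adjmx map_mx0 trmx0. Qed.

Lemma adjmx1 n : (1%:M : 'M[F]_n)^h = 1%:M.
Proof. by rewrite /adjmx map_mx1 trmx1. Qed.

Lemma adjmx_delta m n i j : (delta_mx i j : 'M[F]_(m, n))^h = delta_mx j i.
Proof. by rewrite /adjmx map_delta_mx trmx_delta. Qed.

Lemma adjmx_tr m n (A : 'M[F]_(m, n)) : (A^T)^h = (A^h)^T.
Proof. by apply/matrixP => i j; rewrite !mxE. Qed.

Lemma adjmx_inj m n : injective (@adjmx R k m n).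
Proof. by move=> A B AB; rewrite -[A]adjmxK AB adjmxK. Qed.

Lemma adjmx_mul_diag_ge0 m n (A : 'M[F]_(m, n)) i : 0 <= (A^h *m A) i i.
Proof. by rewrite mxE sumr_ge0 // => j _; rewrite !mxE mul_conj_ge0. Qed.

Lemma adjmx_mul_diag_eq0 m n (A : 'M[F]_(m, n)) :
  (forall i, (A^h *m A) i i = 0) -> A = 0.
Proof.
move=> A0; apply/matrixP => j i; move/eqP: (A0 i); rewrite !mxE psumr_eq0.
  move=> /allP/(_ j); rewrite mem_index_enum !mxE mul_conj_eq0 => /(_ isT).
  by move/eqP.
by move=> j' _; rewrite !mxE mul_conj_ge0.
Qed.

Lemma adjmx_mul_eq0 m n (A : 'M[F]_(m, n)) : A^h *m A = 0 -> A = 0.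
Proof. by move=> A0; apply: adjmx_mul_diag_eq0 => i; rewrite A0 mxE. Qed.

Lemma gram_negative_eigenvector m n (T : 'M[F]_(m, n)) (w : 'cV[F]_n) (l : F) :
  0 < l -> T^h *m (T *m w) = - (l *: w) -> w = 0.
Proof.
move=> l0 Tw; apply: adjmx_mul_diag_eq0 => i; apply/eqP.
have : ((T *m w)^h *m (T *m w)) i i + l * (w^h *m w) i i = 0.
  by rewrite adjmxM -mulmxA Tw mulmxN -scalemxAr !mxE addNr.
move/eqP; rewrite paddr_eq0 ?adjmx_mul_diag_ge0 ?mulr_ge0 ?adjmx_mul_diag_ge0 ?(ltW l0) //.
by case/andP => _; rewrite mulf_eq0 gt_eqF.
Qed.

Lemma unit_normalization n (w : 'cV[F]_n) : w != 0 ->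
  exists2 c : F, c != 0 & (c *: w)^h *m (c *: w) = 1%:M.
Proof.
move=> w0; pose t := (w^h *m w) 0 0.
have t0 : 0 < t.
  rewrite lt_def adjmx_mul_diag_ge0 andbT; apply: contra w0 => /eqP t0.
  by apply/eqP/adjmx_mul_diag_eq0 => i; rewrite ord1.
have [y y0 yE] := gt0_sqrt t0.
exists y^-1; first by rewrite invr_eq0 gt_eqF.
rewrite adjmxZ gt0_conj ?invr_gt0 // -scalemxAl -scalemxAr scalerA.
rewrite -invfM yE [_ *m _]mx11_scalar -/t scale_scalar_mx mulVf ?gt_eqF //.
Qed.

(** The eigenvalue is found over the complex numbers, is positive, hence lies in
    the scalar field; being a root of the characteristic polynomial there, it has
    an eigenvector with entries in that field. *)
Lemma positive_eigenvector m n (P : 'M[F]_(n, m)) : P != 0 ->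
  exists mu (v : 'cV[F]_n),
    [/\ 0 < mu, v^h *m v = 1%:M & P *m (P^h *m v) = mu *: v].
Proof.
move=> P0; pose N := P *m P^h.
have NE : N^emb = gram (P^h)^emb by rewrite -gram_complex adjmxK.
have [i di] : exists i, spectral_diag (gram (P^h)^emb) 0 i != 0.
  apply/existsP; apply: contraNT P0; rewrite negb_exists => /forallP d0.
  have d00 : spectral_diag (gram (P^h)^emb) = 0.
    by apply/rowP => i; rewrite mxE; apply/eqP; have := d0 i; rewrite negbK.
  have := spectral_diag_gram0 d00; rewrite -NE.
  move/map_complex_eq0; rewrite /N -{1}[P]adjmxK => /adjmx_mul_eq0 PH0.
  by rewrite -[P]adjmxK PH0 adjmx0.
set d := spectral_diag _ 0 i in di.
have dS : d \in spectrum (gram (P^h)^emb) by rewrite map_f ?mem_enum.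
have d0 : 0 < d by rewrite lt_def di (spectrum_gram_ge0 dS).
have [mu mu0 muE] := @gt0_to_complex R k _ d0.
have : eigenvalue N mu.
  rewrite eigenvalue_root_char -(fmorph_root toC) map_char_poly NE /= muE.
  by rewrite char_poly_spectrum ?gram_normal // root_prod_XsubC.
case/eigenvalueP => v vN v0.
have [|c c0 cv] := @unit_normalization _ v^h.
  by apply: contra v0 => /eqP v0; rewrite -[v]adjmxK v0 adjmx0.
exists mu, (c *: v^h); split=> //.
rewrite -!scalemxAr mulmxA; have := congr1 (@adjmx R k _ _) vN.
rewrite adjmxZ gt0_conj // !adjmxM adjmxK => ->.
by rewrite scalerA mulrC -scalerA.
Qed.

Lemma eq_delta_linear m n r s (f g : {linear 'M[F]_(m, n) -> 'M[F]_(r, s)}) :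
  (forall i j, f (delta_mx i j) = g (delta_mx i j)) -> f =1 g.
Proof.
move=> fg A; rewrite (matrix_sum_delta A) !linear_sum; apply: eq_bigr => i _.
by rewrite !linear_sum; apply: eq_bigr => j _; rewrite !linearZ fg.
Qed.

Lemma eq_col_delta m n (A B : 'M[F]_(m, n)) :
  (forall i, A *m delta_mx i (0 : 'I_1) = B *m delta_mx i 0) -> A = B.
Proof.
move=> AB; apply/matrixP => i j; have /matrixP/(_ i 0) := AB j.
by rewrite -!colE !mxE.
Qed.

End Adjoint.

Lemma exists_neq N (i : 'I_N) : (1 < N)%N -> exists j, i != j.
Proof.
move=> N1; have [i0|i0] := eqVneq i (Ordinal (ltnW N1)).
  by exists (Ordinal N1); rewrite i0.
by exists (Ordinal (ltnW N1)).
Qed.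

(** * Extracting one isometric block *)
Section Peel.
Variables (R : realType) (k : scalar_kind).
Local Notation F := (scalar_field R k).

Section Relations.
Variables (m n r s : nat) (Phi : {linear 'M[F]_(m, n) -> 'M[F]_(r, s)}).
Hypothesis PhiP : disjointness_preserver Phi.

Local Notation "''f_' ( i , j )" := (Phi (delta_mx i j)) (format "''f_' ( i ,  j )").

Lemma preserver_rank1 (u u' : 'cV_m) (v v' : 'rV_n) :
  u^h *m u' = 0 -> v *m v'^h = 0 -> disjoint_mx (Phi (u *m v)) (Phi (u' *m v')).
Proof.
move=> uu vv; apply: PhiP.
- exact: leq_trans (mxrankM_maxl _ _) (rank_leq_col _).
- exact: leq_trans (mxrankM_maxl _ _) (rank_leq_col _).
split; first by rewrite adjmxM -mulmxA (mulmxA u^h) uu mul0mx mulmx0.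
by rewrite adjmxM -mulmxA (mulmxA v) vv mul0mx mulmx0.
Qed.

Lemma unit_images_disjoint i j i' j' : i != i' -> j != j' ->
  'f_(i, j)^h *m 'f_(i', j') = 0 /\ 'f_(i, j) *m 'f_(i', j')^h = 0.
Proof.
move=> ii jj.
rewrite -(mul_delta_mx (0 : 'I_1)) -(mul_delta_mx (0 : 'I_1) i').
apply: preserver_rank1; first by rewrite adjmx_delta mul_delta_mx_0.
by rewrite adjmx_delta mul_delta_mx_0.
Qed.

Let e (N : nat) (i : 'I_N) : 'cV[F]_N := delta_mx i 0.

Lemma orth_sum_diff N (i i' : 'I_N) : i != i' ->
  (e i + e i')^h *m (e i' - e i) = 0.
Proof.
move=> ii; rewrite /e adjmxD !adjmx_delta mulmxDl !mulmxBr !mul_delta_mx_cond.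
have ii' : i' != i by rewrite eq_sym.
by rewrite !eqxx (negPf ii) (negPf ii') mulr0n subr0 sub0r addNr.
Qed.

Let fE i j : 'f_(i, j) = Phi (e i *m (e j)^h).
Proof. by rewrite adjmx_delta mul_delta_mx. Qed.

(** Disjointness of a + b and d - c, when a is orthogonal to d and b to c, moves a
    product from one pair to the other. *)
Let ortho_exchange m' n' p (a b : 'M[F]_(m', n')) (c d : 'M_(m', p)) :
  a^h *m d = 0 -> b^h *m c = 0 -> (a + b)^h *m (d - c) = 0 ->
  b^h *m d = a^h *m c.
Proof.
move=> ad bc; rewrite adjmxD mulmxDl !mulmxBr ad bc sub0r subr0 addrC => /eqP.
by rewrite subr_eq0 => /eqP.
Qed.

Lemma row_relation i i' j j' : i != i' -> j != j' ->
  'f_(i', j)^h *m 'f_(i', j') = 'f_(i, j)^h *m 'f_(i, j') /\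
  'f_(i', j) *m 'f_(i', j')^h = 'f_(i, j) *m 'f_(i, j')^h.
Proof.
move=> ii jj; have ii' : i' != i by rewrite eq_sym.
have vv : (e j)^h *m (e j')^h^h = 0 by rewrite adjmxK /e adjmx_delta mul_delta_mx_0.
have [] := preserver_rank1 (orth_sum_diff ii) vv.
rewrite mulmxDl mulmxBl linearD linearB -!fE => H1 H2.
have [d1 d2] := unit_images_disjoint ii jj; have [d3 d4] := unit_images_disjoint ii' jj.
split; first exact: ortho_exchange H1.
have := @ortho_exchange _ _ _ ('f_(i, j)^h) ('f_(i', j)^h) ('f_(i, j')^h) ('f_(i', j')^h).
by rewrite -adjmxD !adjmxK -adjmxB; apply.
Qed.

Lemma col_relation i i' j j' : i != i' -> j != j' ->
  'f_(i, j')^h *m 'f_(i', j') = 'f_(i, j)^h *m 'f_(i', j) /\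
  'f_(i, j') *m 'f_(i', j')^h = 'f_(i, j) *m 'f_(i', j)^h.
Proof.
move=> ii jj; have jj' : j' != j by rewrite eq_sym.
have uu : (e i)^h *m (e i') = 0 by rewrite /e adjmx_delta mul_delta_mx_0.
have vv : (e j + e j')^h *m ((e j' - e j)^h)^h = 0 by rewrite adjmxK orth_sum_diff.
have [] := preserver_rank1 uu vv.
rewrite adjmxD adjmxB mulmxDr mulmxBr linearD linearB -!fE => H1 H2.
have [d1 d2] := unit_images_disjoint ii jj; have [d3 d4] := unit_images_disjoint ii jj'.
split; first exact: ortho_exchange H1.
have := @ortho_exchange _ _ _ ('f_(i, j)^h) ('f_(i, j')^h) ('f_(i', j)^h) ('f_(i', j')^h).
by rewrite -adjmxD !adjmxK -adjmxB; apply.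
Qed.

(** Disjointness of the images of (e_i + e_i')(e_j + e_j')^h and of
    (e_i' - e_i)(e_j' - e_j)^h; all the mixed products cancel by the previous
    relations. *)
Lemma square_relation i i' j j' : i != i' -> j != j' ->
  'f_(i, j) *m 'f_(i, j)^h + 'f_(i', j') *m 'f_(i', j')^h =
  'f_(i, j') *m 'f_(i, j')^h + 'f_(i', j) *m 'f_(i', j)^h.
Proof.
move=> ii jj; have ii' : i' != i by rewrite eq_sym.
have jj' : j' != j by rewrite eq_sym.
have vv : (e j + e j')^h *m ((e j' - e j)^h)^h = 0 by rewrite adjmxK orth_sum_diff.
have [_] := preserver_rank1 (orth_sum_diff ii) vv.
rewrite [(e j + _)^h]adjmxD [(e j' - _)^h]adjmxB.
rewrite !mulmxDl !mulmxDr !mulmxN !mulNmx opprK !linearD !linearN /= -!fE.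
have [_ d1] := unit_images_disjoint ii jj; have [_ d2] := unit_images_disjoint ii' jj.
have [_ d3] := unit_images_disjoint ii jj'; have [_ d4] := unit_images_disjoint ii' jj'.
have [_ r1] := row_relation ii jj; have [_ r2] := row_relation ii jj'.
have [_ c1] := col_relation ii jj; have [_ c2] := col_relation ii' jj.
move: r1 r2 c1 c2 d1 d2 d3 d4.
move: 'f_(i, j) 'f_(i, j') 'f_(i', j) 'f_(i', j') => a b c d.
rewrite !adjmxD !adjmxN !mulmxDl !mulmxDr !mulmxN => -> -> -> -> -> -> -> ->.
move: (a *m a^h) (b *m b^h) (c *m c^h) (d *m d^h).
move: (a *m b^h) (b *m a^h) (a *m c^h) (c *m a^h).
move=> X Y Z W A B C' D /matrixP H; apply/matrixP => x y; move: (H x y); rewrite !mxE => E.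
apply/eqP; rewrite -subr_eq0 -E; apply/eqP; ring.
Qed.

Hypothesis m_gt1 : (1 < m)%N.

Let mulmxA_eq p q' t (A : 'M[F]_(p, q')) (B : 'M_(q', t)) C :
  A *m B = C -> forall u (X : 'M_(t, u)), A *m (B *m X) = C *m X.
Proof. by move=> <- u X; rewrite mulmxA. Qed.

(** In the expected form P is E_jl (x) Q1^2 and G i = F_ij^h F_ij is
    E_jj (x) Q1^2 (+) E_ii (x) Q2^2.  On the range of P all the G i agree, and
    P P^h = G i G i' for i <> i', so an eigenvector v of P P^h for mu = la^2 is an
    eigenvector of every G i for la = q^2.  The columns of U are then F_ij v / q
    and those of V^h are F_ic^h F_ij v / q^2, which does not depend on i. *)
Lemma peel (i0 : 'I_m) (j l : 'I_n) : j != l ->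
  'f_(i0, j)^h *m 'f_(i0, l) != 0 ->
  exists (q : F) (U : 'M[F]_(r, m)) (V : 'M[F]_(n, s)),
    [/\ 0 < q, U^h *m U = 1%:M, V *m V^h = 1%:M,
        forall A, Phi A *m V^h = q *: (U *m A) &
        forall A, U^h *m Phi A = q *: (A *m V)].
Proof.
move=> jl; set P := _ *m _ => P0.
have lj : l != j by rewrite eq_sym.
have PE i : 'f_(i, j)^h *m 'f_(i, l) = P.
  by have [->//|ii] := eqVneq i i0; have [] := row_relation ii jl.
clearbody P.
have [mu [v [mu0 vv PPv]]] := positive_eigenvector P0.
have [la la0 laE] := gt0_sqrt mu0; have [q q0 qE] := gt0_sqrt la0.
have qn0 : q != 0 by rewrite gt_eqF.
have lan0 : la != 0 by rewrite gt_eqF.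
pose w := mu^-1 *: (P^h *m v).
have vE : v = P *m w by rewrite -scalemxAr PPv scalerA mulVf ?gt_eqF // scale1r.
pose G i := 'f_(i, j)^h *m 'f_(i, j).
have GP i i' : i != i' -> G i *m P = G i' *m P.
  move=> ii; have ii' : i' != i by rewrite eq_sym.
  have [_ c2] := col_relation ii' jl; have [d1 _] := unit_images_disjoint ii jl.
  have [d2 _] := unit_images_disjoint ii' jl; have sq := square_relation ii jl.
  rewrite /G -(PE i) -!mulmxA.
  rewrite (mulmxA_eq (esym c2)) -!mulmxA [RHS]mulmxA (PE i').
  have := congr1 (fun X => 'f_(i, j)^h *m (X *m 'f_(i, l))) sq.
  rewrite !mulmxDl !mulmxDr -!mulmxA d2 !mulmx0 addr0.
  rewrite [X in _ + X = _]mulmxA d1 mul0mx addr0 => ->.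
  by rewrite mulmxA PE.
have Gv i i' : G i *m v = G i' *m v.
  by have [->//|ii] := eqVneq i i'; rewrite vE !mulmxA (GP _ _ ii).
have PPE i i' : i != i' -> P *m P^h = G i *m G i'.
  move=> ii; have [_ c2] := col_relation ii jl.
  rewrite -{1}(PE i) -(PE i') adjmxM adjmxK -!mulmxA (mulmxA_eq c2).
  by rewrite -!mulmxA.
(* Here (G i)^2 v = la^2 v, and the residue G i v - la v would be an eigenvector
   of the positive matrix G i for the negative eigenvalue - la. *)
have Gla i : G i *m v = la *: v.
  have [i' ii] := exists_neq i m_gt1.
  have GGv : G i *m (G i *m v) = mu *: v.
    by rewrite (Gv i i') mulmxA -(PPE _ _ ii) -mulmxA.
  apply/eqP; rewrite -subr_eq0; apply/eqP.
  apply: (@gram_negative_eigenvector _ _ _ _ 'f_(i, j) _ la la0).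
  by rewrite mulmxA -/(G i) mulmxBr GGv -scalemxAr -laE -scalerA -scalerBr -scalerN opprB.
pose u i := q^-1 *: ('f_(i, j) *m v).
pose z c := la^-1 *: ('f_(i0, c)^h *m ('f_(i0, j) *m v)).
have zE c i : 'f_(i, c)^h *m ('f_(i, j) *m v) = la *: z c.
  rewrite /z scalerA mulfV // scale1r !mulmxA.
  have [->|cj] := eqVneq c j; first exact: Gv.
  have [->//|ii] := eqVneq i i0.
  by have [-> _] := row_relation ii cj.
have zj : z j = v by rewrite /z mulmxA Gla scalerA mulVf // scale1r.
have uE i c : 'f_(i, c)^h *m u i = q *: z c.
  by rewrite /u -scalemxAr zE -qE scalerA mulKf.
have uE0 a b c : a != b -> 'f_(a, c)^h *m u b = 0.
  move=> ab; rewrite /u -scalemxAr; have [->|cj] := eqVneq c j; last first.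
    by have [d1 _] := unit_images_disjoint ab cj; rewrite mulmxA d1 mul0mx scaler0.
  have ba : b != a by rewrite eq_sym.
  have [_ c2] := col_relation ba lj; have [d1 _] := unit_images_disjoint ab jl.
  rewrite vE -(PE a) -!mulmxA (mulmxA_eq c2) -!mulmxA (mulmxA_eq d1).
  by rewrite mul0mx scaler0.
have fz a b c : 'f_(a, c) *m z b = (q *+ (c == b)) *: u a.
  have [i' ai] := exists_neq a m_gt1; have ia : i' != a by rewrite eq_sym.
  have -> : z b = la^-1 *: ('f_(i', b)^h *m ('f_(i', j) *m v)).
    by rewrite zE scalerA mulVf // scale1r.
  rewrite -scalemxAr; have [<-|cb] := eqVneq c b; last first.
    by have [_ d2] := unit_images_disjoint ai cb; rewrite (mulmxA_eq d2) mul0mx scaler0 scale0r.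
  have E : 'f_(a, c) *m 'f_(i', c)^h = 'f_(a, j) *m 'f_(i', j)^h.
    have [->//|cj] := eqVneq c j.
    have jc : j != c by rewrite eq_sym.
    by have [_ ->] := col_relation ai jc.
  rewrite (mulmxA_eq E) -mulmxA [_^h *m _]mulmxA Gla -scalemxAr scalerA mulVf // scale1r.
  by rewrite /u mulr1n scalerA mulfV // scale1r.
pose U : 'M[F]_(r, m) := \matrix_(x, a) u a x 0.
pose Z : 'M[F]_(s, n) := \matrix_(x, c) z c x 0.
have Ue a : U *m delta_mx a 0 = u a.
  by rewrite -colE; apply/colP => x; rewrite !mxE.
have Ze c : Z *m delta_mx c 0 = z c.
  by rewrite -colE; apply/colP => x; rewrite !mxE.
have PhiZ A : Phi A *m Z = q *: (U *m A).
  apply: (@eq_delta_linear _ _ _ _ _ _ (mulmxr Z \o Phi) (q \*: mulmx U)) => a c.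
  apply: eq_col_delta => b /=.
  rewrite -mulmxA Ze fz -scalemxAl -mulmxA mul_delta_mx_cond.
  by case: (c == b); rewrite ?mulr1n ?mulr0n ?Ue // mulmx0 scaler0 scale0r.
have UPhi A : U^h *m Phi A = q *: (A *m Z^h).
  apply: (@eq_delta_linear _ _ _ _ _ _ (mulmx U^h \o Phi) (q \*: mulmxr Z^h)) => a c.
  apply: adjmx_inj; apply: eq_col_delta => b /=.
  rewrite adjmxM adjmxZ gt0_conj // adjmxM !adjmxK adjmx_delta.
  rewrite -mulmxA Ue -scalemxAl -mulmxA mul_delta_mx_cond.
  have [<-|ab] := eqVneq a b; first by rewrite uE mulr1n Ze.
  by rewrite uE0 // mulr0n mulmx0 scaler0.
(* Comparing the two computations of U^h Phi(A) Z shows that U^h U and Z^h Z are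
   the same scalar matrix; the scalar is 1 because column j of Z is the unit vector v. *)
have UAZ A : U^h *m U *m A = A *m (Z^h *m Z).
  have := mulmxA U^h (Phi A) Z.
  rewrite PhiZ UPhi -scalemxAr -scalemxAl => /(scalerI qn0).
  by rewrite !mulmxA.
have ZZj : (Z^h *m Z) j j = 1.
  have : (Z *m delta_mx j (0 : 'I_1))^h *m (Z *m delta_mx j 0) = 1%:M.
    by rewrite Ze zj.
  rewrite adjmxM adjmx_delta -mulmxA (mulmxA Z^h) -colE -rowE.
  by move/matrixP/(_ 0 0); rewrite [X in X = _]mxE [X in X = _]mxE => ->; rewrite mxE.
have UZ a b c d : (U^h *m U) a b *+ (d == c) = (Z^h *m Z) d c *+ (a == b).
  have /matrixP/(_ a c) := UAZ (delta_mx b d).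
  have mul_delta (M : 'M[F]_m) : (M *m delta_mx b d) a c = M a b *+ (d == c).
    rewrite mxE (bigD1 b) //= big1 => [|i /negPf bi]; last by rewrite !mxE bi mulr0.
    by rewrite mxE eqxx addr0 mulr_natr eq_sym.
  have delta_mul (M : 'M[F]_n) : (delta_mx b d *m M) a c = M d c *+ (a == b).
    rewrite mxE (bigD1 d) //= big1 => [|i /negPf di]; last by rewrite !mxE di andbF mul0r.
    by rewrite mxE eqxx andbT addr0 mulr_natl.
  by rewrite mul_delta delta_mul.
exists q, U, Z^h; split=> //; rewrite ?adjmxK //.
- apply/matrixP => a b; have := UZ a b j j.
  by rewrite eqxx mulr1n ZZj => ->; rewrite mxE.
- apply/matrixP => c d; have := UZ i0 i0 d c.
  rewrite eqxx mulr1n => <-; have := UZ i0 i0 j j.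
  by rewrite !eqxx !mulr1n ZZj => ->; rewrite mxE.
Qed.

End Relations.
End Peel.

(** * Splitting a disjointness preserver into blocks *)
Section Decomposition.
Variables (R : realType) (k : scalar_kind).
Local Notation F := (scalar_field R k).

(** The blocks are recorded by how they intertwine Phi, with arg either the
    identity or the transposition, rather than as summands of Phi: these
    identities survive when further blocks are added, and they imply that blocks
    of different kinds are orthogonal.  The families are indexed by all natural
    numbers to avoid dependent types; only the values below q are meaningful. *)
Record block_family m n p t r s (arg : 'M[F]_(m, n) -> 'M[F]_(p, t))
   (Phi : 'M[F]_(m, n) -> 'M[F]_(r, s)) (q : nat) (c : nat -> F)
   (X : nat -> 'M[F]_(r, p)) (Y : nat -> 'M[F]_(t, s)) : Prop := BlockFamily {
  bf_gt0 : forall a, (a < q)%N -> 0 < c a;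
  bf_right : forall a A, (a < q)%N -> Phi A *m (Y a)^h = c a *: (X a *m arg A);
  bf_left : forall a A, (a < q)%N -> (X a)^h *m Phi A = c a *: (arg A *m Y a);
  bf_orthX : forall a b, (a < q)%N -> (b < q)%N -> (X a)^h *m X b = (a == b)%:R%:M;
  bf_orthY : forall a b, (a < q)%N -> (b < q)%N -> Y a *m (Y b)^h = (a == b)%:R%:M }.

Definition fcons T (x : T) (f : nat -> T) (a : nat) : T :=
  if a is b.+1 then f b else x.

Lemma mulmx_all0l m n p (X : 'M[F]_(p, m)) : (0 < n)%N ->
  (forall A : 'M_(m, n), X *m A = 0) -> X = 0.
Proof.
case: n => // n _ X0; apply: eq_col_delta => i.
have := congr1 (fun M => M *m delta_mx (0 : 'I_n.+1) (0 : 'I_1)) (X0 (delta_mx i 0)).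
by rewrite -mulmxA mul_delta_mx !mul0mx.
Qed.

Lemma mulmx_all0r m n p (X : 'M[F]_(n, p)) : (0 < m)%N ->
  (forall A : 'M_(m, n), A *m X = 0) -> X = 0.
Proof.
move=> m0 X0; apply: adjmx_inj; rewrite adjmx0; apply: (mulmx_all0l m0) => A.
by rewrite -[A]adjmxK -adjmxM X0 adjmx0.
Qed.

Section Family.
Variables (m n p t r s : nat) (arg : 'M[F]_(m, n) -> 'M[F]_(p, t)).
Hypotheses (p0 : (0 < p)%N) (t0 : (0 < t)%N).
Hypothesis arg_surj : forall B, exists A, arg A = B.
Variables (Phi : 'M[F]_(m, n) -> 'M[F]_(r, s)).
Variables (q : nat) (c : nat -> F) (X : nat -> 'M[F]_(r, p)) (Y : nat -> 'M[F]_(t, s)).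
Hypothesis bf : block_family arg Phi q c X Y.

(** The columns of X a lie in the span of the ranges of the Phi A. *)
Lemma family_left0 u (W : 'M_(u, r)) a : (a < q)%N ->
  (forall A, W *m Phi A = 0) -> W *m X a = 0.
Proof.
move=> aq W0; apply: (mulmx_all0l t0) => B; have [A <-] := arg_surj B.
apply: (scalerI (lt0r_neq0 (bf_gt0 bf aq))).
by rewrite -mulmxA scalemxAr -(bf_right bf) // mulmxA W0 mul0mx scaler0.
Qed.

Lemma family_right0 u (Z : 'M_(s, u)) a : (a < q)%N ->
  (forall A, Phi A *m Z = 0) -> Y a *m Z = 0.
Proof.
move=> aq Z0; apply: (mulmx_all0r p0) => B; have [A <-] := arg_surj B.
apply: (scalerI (lt0r_neq0 (bf_gt0 bf aq))).
by rewrite mulmxA scalemxAl -(bf_left bf) // -mulmxA Z0 mulmx0 scaler0.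
Qed.

Lemma family_extend_other p' t' (B : 'M[F]_(m, n) -> 'M[F]_(p', t'))
    (U : 'M_(r, p')) (V : 'M_(t', s)) :
  (forall A, U^h *m Phi A = 0) -> (forall A, Phi A *m V^h = 0) ->
  block_family arg (fun A => U *m B A *m V + Phi A) q c X Y.
Proof.
move=> U0 V0.
have XU a : (a < q)%N -> (X a)^h *m U = 0.
  by move=> aq; rewrite -[U]adjmxK -adjmxM (family_left0 aq U0) adjmx0.
have YV a : (a < q)%N -> V *m (Y a)^h = 0.
  by move=> aq; rewrite -[V]adjmxK -adjmxM (family_right0 aq V0) adjmx0.
case: (bf) => b1 b2 b3 b4 b5; split=> // a A aq.
  by rewrite mulmxDl -mulmxA YV // mulmx0 add0r b2.
by rewrite mulmxDr !mulmxA XU // !mul0mx add0r b3.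
Qed.

Lemma family_extend (d : F) (U : 'M_(r, p)) (V : 'M_(t, s)) :
  0 < d -> U^h *m U = 1%:M -> V *m V^h = 1%:M ->
  (forall A, U^h *m Phi A = 0) -> (forall A, Phi A *m V^h = 0) ->
  block_family arg (fun A => U *m (d *: arg A) *m V + Phi A) q.+1
    (fcons d c) (fcons U X) (fcons V Y).
Proof.
move=> d0 UU VV U0 V0.
have UX a : (a < q)%N -> U^h *m X a = 0 by move=> aq; apply: family_left0.
have YV a : (a < q)%N -> Y a *m V^h = 0 by move=> aq; apply: family_right0.
have XU a : (a < q)%N -> (X a)^h *m U = 0.
  by move=> aq; rewrite -[U]adjmxK -adjmxM UX // adjmx0.
have VY a : (a < q)%N -> V *m (Y a)^h = 0.
  by move=> aq; rewrite -[V]adjmxK -adjmxM YV // adjmx0.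
have [b1 b2 b3 b4 b5] := family_extend_other (fun A => d *: arg A) U0 V0.
have scal0 N : (0 : F)%:M = 0 :> 'M[F]_N by rewrite raddf0.
split; first by case.
- case=> [|a] A aq; last exact: b2.
  by rewrite /= mulmxDl V0 addr0 -mulmxA VV mulmx1 scalemxAr.
- case=> [|a] A aq; last exact: b3.
  by rewrite /= mulmxDr U0 addr0 !mulmxA UU mul1mx scalemxAl.
- by case=> [|a] [|b] aq bq //=; rewrite ?UX ?XU ?eqxx ?b4 ?scal0.
- by case=> [|a] [|b] aq bq //=; rewrite ?YV ?VY ?eqxx ?b5 ?scal0.
Qed.

End Family.

Lemma family_ext m n p t r s (arg : 'M[F]_(m, n) -> 'M[F]_(p, t))
   (Phi Psi : 'M[F]_(m, n) -> 'M[F]_(r, s)) q c X Y : Phi =1 Psi ->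
   block_family arg Phi q c X Y -> block_family arg Psi q c X Y.
Proof.
by move=> E [b1 b2 b3 b4 b5]; split=> // a A aq; rewrite -E ?b2 ?b3.
Qed.

Definition family_sum p t r s q (c : nat -> F) (X : nat -> 'M[F]_(r, p))
  (Y : nat -> 'M[F]_(t, s)) (B : 'M[F]_(p, t)) : 'M[F]_(r, s) :=
  \sum_(a < q) X a *m (c a *: B) *m Y a.

Lemma family_sum_cons p t r s q d U V c X Y B :
  @family_sum p t r s q.+1 (fcons d c) (fcons U X) (fcons V Y) B =
  U *m (d *: B) *m V + family_sum q c X Y B.
Proof. by rewrite /family_sum big_ord_recl. Qed.

Definition block_decomposition m n r s (Phi : 'M[F]_(m, n) -> 'M[F]_(r, s)) :=
  exists q1 c1 X1 Y1 q2 c2 X2 Y2,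
   [/\ block_family id Phi q1 c1 X1 Y1, block_family trmx Phi q2 c2 X2 Y2 &
       forall A, Phi A = family_sum q1 c1 X1 Y1 A + family_sum q2 c2 X2 Y2 A^T].

Section Induction.
Variables (m n : nat).
Hypotheses (m_gt1 : (1 < m)%N) (n_gt1 : (1 < n)%N).

Lemma disjointness_preserver_tr r s (Phi : {linear 'M[F]_(m, n) -> 'M[F]_(r, s)}) :
  disjointness_preserver Phi -> disjointness_preserver (Phi \o trmx).
Proof.
move=> PhiP A B rA rB [AB BA]; apply: PhiP; rewrite ?mxrank_tr //; split.
  by rewrite adjmx_tr -trmx_mul -[B]adjmxK -adjmxM BA adjmx0 trmx0.
by rewrite adjmx_tr -trmx_mul -[A]adjmxK -adjmxM AB adjmx0 trmx0.
Qed.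

Lemma zero_or_delta r s (Phi : {linear 'M[F]_(m, n) -> 'M[F]_(r, s)}) :
  (forall A, Phi A = 0) \/ exists i j, Phi (delta_mx i j) != 0.
Proof.
have [/existsP[[i j] Pij]|] := boolP [exists ij : 'I_m * 'I_n, Phi (delta_mx ij.1 ij.2) != 0].
  by right; exists i, j.
rewrite negb_exists => /forallP H; left=> A.
rewrite (matrix_sum_delta A) linear_sum big1 // => i _.
rewrite linear_sum big1 // => j _; rewrite linearZ /=.
by have := H (i, j); rewrite negbK => /eqP ->; rewrite scaler0.
Qed.

(** With T = F_il, the square relation gives
    T T^h T = F_ij F_ij^h T + F_i'l F_i'l^h T, so F_ij^h T or F_i'l^h T is nonzero.
    The former starts a block for A, the latter a block for its transpose. *)
Lemma nonzero_link r s (Phi : {linear 'M[F]_(m, n) -> 'M[F]_(r, s)}) i l :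
  disjointness_preserver Phi -> Phi (delta_mx i l) != 0 ->
  (exists i j l, j != l /\
     (Phi (delta_mx i j))^h *m Phi (delta_mx i l) != 0) \/
  (exists i i' j, i != i' /\
     (Phi (delta_mx i j))^h *m Phi (delta_mx i' j) != 0).
Proof.
move=> PhiP T0; have [j lj] := exists_neq l n_gt1; have [i' ii] := exists_neq i m_gt1.
have jl : j != l by rewrite eq_sym.
have ii' : i' != i by rewrite eq_sym.
have [H1|H1] := eqVneq ((Phi (delta_mx i j))^h *m Phi (delta_mx i l)) 0; last first.
  by left; exists i, j, l.
have [H2|H2] := eqVneq ((Phi (delta_mx i' l))^h *m Phi (delta_mx i l)) 0; last first.
  by right; exists i', i, l.
have [H3 _] := unit_images_disjoint PhiP ii' jl.
have := congr1 (mulmx^~ (Phi (delta_mx i l))) (square_relation PhiP ii jl).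
rewrite /= !mulmxDl -!mulmxA H1 H2 H3 !mulmx0 !addr0 => /esym H.
case/negP: T0; apply/eqP; apply: adjmx_mul_eq0; apply: adjmx_mul_eq0.
by rewrite adjmxM adjmxK -mulmxA H mulmx0.
Qed.

(** Psi is Phi minus the extracted block; writing it as (1 - U U^h) Phi makes its
    linearity and the inclusion of row spaces evident. *)
Lemma residual_preserver r s (Phi : {linear 'M[F]_(m, n) -> 'M[F]_(r, s)})
    p t (arg : 'M[F]_(m, n) -> 'M[F]_(p, t)) (q : F) (U : 'M_(r, p)) (V : 'M_(t, s)) :
  disjointness_preserver Phi ->
  (forall A B, disjoint_mx A B -> (arg A)^h *m arg B = 0) ->
  U^h *m U = 1%:M -> V *m V^h = 1%:M ->
  (forall A, Phi A *m V^h = q *: (U *m arg A)) ->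
  (forall A, U^h *m Phi A = q *: (arg A *m V)) ->
  let Psi := mulmx (1%:M - U *m U^h) \o Phi in
  [/\ forall A, Phi A = U *m (q *: arg A) *m V + Psi A,
      forall A, U^h *m Psi A = 0, forall A, Psi A *m V^h = 0 &
      disjointness_preserver Psi].
Proof.
move=> PhiP argD UU VV PV UP Psi.
have PsiE A : Psi A = Phi A - U *m (q *: arg A) *m V.
  by rewrite /Psi /= mulmxBl mul1mx -(mulmxA U U^h) UP -mulmxA scalemxAl.
have H1 A : Phi A = U *m (q *: arg A) *m V + Psi A by rewrite PsiE addrC subrK.
have H2 A : U^h *m Psi A = 0.
  by rewrite /Psi /= mulmxA mulmxBr mulmx1 mulmxA UU mul1mx subrr mul0mx.
have H3 A : Psi A *m V^h = 0.
  by rewrite PsiE mulmxBl PV -(mulmxA _ V) VV mulmx1 scalemxAr subrr.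
split=> // A B rA rB AB; have [d1 d2] := PhiP _ _ rA rB AB.
have H4 : (1%:M - U *m U^h)^h = 1%:M - U *m U^h.
  by rewrite adjmxB adjmx1 adjmxM adjmxK.
split.
  rewrite {1}/Psi /= adjmxM H4 -mulmxA mulmxBl mul1mx -mulmxA H2 mulmx0 subr0.
  rewrite /Psi /= mulmxBl mul1mx mulmxBr d1 sub0r -mulmxA UP.
  rewrite mulmxA -[_ *m U]adjmxK adjmxM adjmxK UP adjmxZ adjmxM.
  rewrite -scalemxAl -scalemxAr -mulmxA (mulmxA _ (arg B)) argD //.
  by rewrite mul0mx mulmx0 !scaler0 oppr0.
by rewrite /Psi /= adjmxM !mulmxA -[_ *m Phi A *m _]mulmxA d2 mulmx0 mul0mx.
Qed.

Let i0 : 'I_m := Ordinal (ltnW m_gt1).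
Let j0 : 'I_n := Ordinal (ltnW n_gt1).

Lemma residual_rank r s p t (Phi Psi : 'M[F]_(m, n) -> 'M[F]_(r, s))
    (arg : 'M[F]_(m, n) -> 'M[F]_(p, t)) (q : F) (U : 'M_(r, p)) (V : 'M_(t, s)) A :
  0 < q -> U^h *m U = 1%:M -> V *m V^h = 1%:M -> arg A != 0 ->
  (forall A, Phi A *m V^h = q *: (U *m arg A)) ->
  (forall A, Psi A *m V^h = 0) -> (Psi A <= Phi A)%MS ->
  (\rank (Psi A) < \rank (Phi A))%N.
Proof.
move=> q0 UU VV A0 PV Psi0 le; apply: rank_ltmx; rewrite ltmxE le /=.
apply: contra A0 => /submxP[D E]; apply/eqP.
have : q *: (U *m arg A) = 0 by rewrite -PV E -mulmxA Psi0 mulmx0.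
move/eqP; rewrite scaler_eq0 gt_eqF //= => /eqP/(congr1 (mulmx U^h)).
by rewrite mulmxA UU mul1mx mulmx0.
Qed.

(** Induction on the rank of the image of one fixed matrix unit: every block
    is injective, so each extraction lowers this rank. *)
Lemma disjointness_preserver_decomposition r s
    (Phi : {linear 'M[F]_(m, n) -> 'M[F]_(r, s)}) :
  disjointness_preserver Phi -> block_decomposition Phi.
Proof.
have [N] := ubnP (\rank (Phi (delta_mx i0 j0))).
elim: N => // N IH in Phi *; rewrite ltnS => leN PhiP.
have [Phi0|[i [j Pij]]] := zero_or_delta Phi.
  exists 0, (fun=> 0), (fun=> 0), (fun=> 0), 0, (fun=> 0), (fun=> 0), (fun=> 0).
  by split=> // A; rewrite Phi0 /family_sum !big_ord0 addr0.
have m0 := ltnW m_gt1; have n0 := ltnW n_gt1.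
have id_surj (B : 'M[F]_(m, n)) : exists A, id A = B by exists B.
have tr_surj (B : 'M[F]_(n, m)) : exists A, A^T = B by exists B^T; rewrite trmxK.
have d0 : delta_mx i0 j0 != 0 :> 'M[F]_(m, n).
  by rewrite -mxrank_eq0 mxrank_delta.
have [[a [b [l [bl Pabl]]]]|[a [a' [b [aa Paab]]]]] := nonzero_link PhiP Pij.
  have [q [U [V [q0 UU VV PV UP]]]] := peel PhiP m_gt1 bl Pabl.
  have argD (A B : 'M[F]_(m, n)) : disjoint_mx A B -> (id A)^h *m id B = 0 by case.
  have [PhiE U0 V0 PsiP] := residual_preserver (arg := id) PhiP argD UU VV PV UP.
  set Psi := _ \o _ in PhiE U0 V0 PsiP.
  have rkPsi : (\rank (Psi (delta_mx i0 j0)) < N)%N.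
    apply: leq_trans _ leN.
    by apply: residual_rank q0 UU VV d0 PV V0 _; apply: submxMl.
  have [q1 [c1 [X1 [Y1 [q2 [c2 [X2 [Y2 [bf1 bf2 PsiE]]]]]]]]] := IH Psi rkPsi PsiP.
  exists q1.+1, (fcons q c1), (fcons U X1), (fcons V Y1), q2, c2, X2, Y2; split.
  - by apply: family_ext (family_extend m0 n0 id_surj bf1 q0 UU VV U0 V0) => A; rewrite PhiE.
  - have bf := family_extend_other n0 m0 tr_surj bf2 (fun A => q *: A) U0 V0.
    by apply: family_ext bf => A; rewrite PhiE.
  - by move=> A; rewrite family_sum_cons -addrA -PsiE PhiE.
have Paab' : ((Phi \o trmx) (delta_mx b a))^h *m (Phi \o trmx) (delta_mx b a') != 0.
  by rewrite /= !trmx_delta.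
have [q [U [V [q0 UU VV PV' UP']]]] := peel (disjointness_preserver_tr PhiP) n_gt1 aa Paab'.
have PV A : Phi A *m V^h = q *: (U *m A^T) by rewrite -PV' /= trmxK.
have UP A : U^h *m Phi A = q *: (A^T *m V) by rewrite -UP' /= trmxK.
have argD (A B : 'M[F]_(m, n)) : disjoint_mx A B -> (A^T)^h *m B^T = 0.
  by case=> _ AB; rewrite adjmx_tr -trmx_mul -[B]adjmxK -adjmxM AB adjmx0 trmx0.
have [PhiE U0 V0 PsiP] := residual_preserver (arg := trmx) PhiP argD UU VV PV UP.
set Psi := _ \o _ in PhiE U0 V0 PsiP.
have rkPsi : (\rank (Psi (delta_mx i0 j0)) < N)%N.
  apply: leq_trans _ leN.
  apply: residual_rank q0 UU VV _ PV V0 _; last exact: submxMl.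
  by rewrite -mxrank_eq0 mxrank_tr mxrank_delta.
have [q1 [c1 [X1 [Y1 [q2 [c2 [X2 [Y2 [bf1 bf2 PsiE]]]]]]]]] := IH Psi rkPsi PsiP.
exists q1, c1, X1, Y1, q2.+1, (fcons q c2), (fcons U X2), (fcons V Y2); split.
- have bf := family_extend_other m0 n0 id_surj bf1 (fun A => q *: A^T) U0 V0.
  by apply: family_ext bf => A; rewrite PhiE.
- by apply: family_ext (family_extend n0 m0 tr_surj bf2 q0 UU VV U0 V0) => A; rewrite PhiE.
- by move=> A; rewrite family_sum_cons addrCA -PsiE PhiE.
Qed.

End Induction.
End Decomposition.

(** * Assembling the normal form *)
Section Assembly.
Variables (R : realType) (k : scalar_kind).
Local Notation F := (scalar_field R k).
Local Notation toC := (@to_complex R k).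
Local Notation "A ^emb" := (map_mx toC A) (at level 8, format "A ^emb").

(** Column (i, a) is column i of X a, in the order used by the Kronecker product,
    so that right multiplication by B *t Q acts block by block. *)
Definition assemble r p q (X : nat -> 'M[F]_(r, p)) : 'M[F]_(r, p * q) :=
  \matrix_(x, l) X (mxtens_unindex l).2 x (mxtens_unindex l).1.

Lemma sum_mxtens (V : nmodType) p q (f : 'I_(p * q) -> V) :
  \sum_l f l = \sum_i \sum_j f (mxtens_index (i, j)).
Proof.
rewrite pair_big (reindex (@mxtens_index p q)) /=.
  by apply: eq_bigr => -[].
by exists (@mxtens_unindex p q) => l _; rewrite ?mxtens_indexK ?mxtens_unindexK.
Qed.

Lemma assemble_tens r p t q (X : nat -> 'M[F]_(r, p)) (B : 'M[F]_(p, t)) (c : nat -> F) :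
  assemble q X *m (B *t diag_mx (\row_(a < q) c a)) =
  assemble q (fun a => X a *m (c a *: B)).
Proof.
apply/matrixP => x l; case: (mxtens_indexP l) => l1 l2; rewrite !mxE sum_mxtens !mxtens_indexK.
apply: eq_bigr => i _; rewrite (bigD1 l2) //= big1 => [|j /negPf jl].
  by rewrite tensmxE !mxE !mxtens_indexK /= eqxx mulr1n addr0 [B _ _ * _]mulrC.
by rewrite tensmxE [diag_mx _ _ _]mxE jl mulr0n !mulr0.
Qed.

Lemma assemble_adj r s p q (X : nat -> 'M[F]_(r, p)) (Z : nat -> 'M[F]_(s, p)) :
  assemble q X *m (assemble q Z)^h = \sum_(a < q) X a *m (Z a)^h.
Proof.
apply/matrixP => x y; rewrite !mxE sum_mxtens exchange_big summxE /=.
apply: eq_bigr => a _; rewrite mxE; apply: eq_bigr => i _.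
by rewrite !mxE mxtens_indexK.
Qed.

Lemma adj_assemble r p p' q q' (X : nat -> 'M[F]_(r, p)) (Z : nat -> 'M[F]_(r, p')) l l' :
  ((assemble q X)^h *m assemble q' Z) l l' =
  ((X (mxtens_unindex l).2)^h *m Z (mxtens_unindex l').2)
     (mxtens_unindex l).1 (mxtens_unindex l').1.
Proof. by rewrite !mxE; apply: eq_bigr => x _; rewrite !mxE. Qed.

Lemma assemble_isometry r p q (X : nat -> 'M[F]_(r, p)) :
  (forall a b, (a < q)%N -> (b < q)%N -> (X a)^h *m X b = (a == b)%:R%:M) ->
  (assemble q X)^h *m assemble q X = 1%:M.
Proof.
move=> orthX; apply/matrixP => l l'; rewrite adj_assemble orthX //.
case: (mxtens_indexP l) => i a; case: (mxtens_indexP l') => i' a'.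
rewrite !mxtens_indexK /= !mxE (can_eq (@mxtens_indexK _ _)) xpair_eqE.
by rewrite -(val_eqE a a') andbC; case: eqP; case: eqP; rewrite ?mul0rn.
Qed.

Lemma assemble_cross r p p' q q' (X : nat -> 'M[F]_(r, p)) (Z : nat -> 'M[F]_(r, p')) :
  (forall a b, (a < q)%N -> (b < q')%N -> (X a)^h *m Z b = 0) ->
  (assemble q X)^h *m assemble q' Z = 0.
Proof. by move=> XZ; apply/matrixP => l l'; rewrite adj_assemble XZ ?mxE. Qed.

Lemma isometry_leq r d (W : 'M[F]_(r, d)) : W^h *m W = 1%:M -> (d <= r)%N.
Proof.
move=> WW; rewrite -[d](mxrank1 F) -WW; apply: leq_trans (mxrankM_maxr _ _) (rank_leq_row _).
Qed.

Lemma isometry_row_mx r d d' (W : 'M[F]_(r, d)) (W' : 'M[F]_(r, d')) :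
  W^h *m W = 1%:M -> W^h *m W' = 0 -> W'^h *m W' = 1%:M ->
  (row_mx W W')^h *m row_mx W W' = 1%:M.
Proof.
move=> WW WW' W'W'; have W'W : W'^h *m W = 0.
  by rewrite -[W]adjmxK -adjmxM WW' adjmx0.
rewrite /adjmx map_row_mx tr_row_mx -!/(adjmx _) mul_col_row WW WW' W'W W'W'.
by rewrite -scalar_mx_block.
Qed.

(** Columns are added one at a time, each a normalized vector of the kernel of
    the adjoint of the matrix obtained so far. *)
Lemma isometry_complete r d e (W : 'M[F]_(r, d)) : W^h *m W = 1%:M -> (d + e = r)%N ->
  exists W' : 'M[F]_(r, e), (row_mx W W')^h *m row_mx W W' = 1%:M.
Proof.
move=> WW der; suff [W' WW' W'W'] : exists2 W' : 'M[F]_(r, e),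
    W^h *m W' = 0 & W'^h *m W' = 1%:M.
  by exists W'; apply: isometry_row_mx.
elim: e d W WW der => [|e IH] d W WW der.
  by exists 0; apply/matrixP => i; [rewrite mulmx0 | case: i].
have [u u1 Wu] : exists2 u : 'cV[F]_r, u^h *m u = 1%:M & W^h *m u = 0.
  have K0 : kermx W != 0.
    rewrite -mxrank_eq0 mxrank_ker subn_eq0 -ltnNge.
    by apply: leq_ltn_trans (rank_leq_col _) _; rewrite -der addnS ltnS leq_addr.
  have [|c c0 cu] := @unit_normalization _ _ _ (nz_row (kermx W))^h.
    apply: contra K0 => /eqP E; rewrite -nz_row_eq0 -[nz_row _]adjmxK E.
    by rewrite adjmx0.
  exists (c *: (nz_row (kermx W))^h) => //.
  rewrite -scalemxAr -adjmxM.
  have /sub_kermxP -> : (nz_row (kermx W) <= kermx W)%MS by apply: nz_row_sub.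
  by rewrite adjmx0 scaler0.
have [|W' WW' W'W'] := IH (d + 1)%N (row_mx W u) (isometry_row_mx WW Wu u1).
  by rewrite -der addn1 addSnnS.
move: WW'; rewrite /adjmx map_row_mx tr_row_mx -!/(adjmx _) mul_col_mx.
rewrite -(col_mx0 F) => /eq_col_mx[WW' uW'].
exists (row_mx u W' : 'M_(r, 1 + e)); last exact: (isometry_row_mx u1 uW' W'W').
by have := mul_mx_row W^h u W'; rewrite Wu WW' row_mx0.
Qed.

Lemma castmx_sandwich p r q s (er : p = r) (es : q = s)
    (U : 'M[F]_(r, p)) (D : 'M[F]_(p, q)) (V : 'M[F]_(q, s)) :
  castmx (erefl r, er) U *m castmx (er, es) D *m castmx (es, erefl s) V =
  U *m D *m V.
Proof. by case: _ / er U; case: _ / es V => V U; rewrite !castmx_id. Qed.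

Lemma unitary_castmx p r (er : p = r) (U : 'M[F]_(r, p)) : U^h *m U = 1%:M ->
  unitary_mx (castmx (erefl r, er) U).
Proof. by case: _ / er U => U UU; rewrite /unitary_mx castmx_id. Qed.

Lemma adjmx_castmx p r (er : p = r) (U : 'M[F]_(r, p)) :
  (castmx (erefl r, er) U)^h = castmx (er, erefl r) U^h.
Proof. by case: _ / er U => U; rewrite !castmx_id. Qed.

(** No nonzero pair intertwines A and its transpose: at A = E_ij the left side has
    all its entries in row i, the right side all its entries in column i. *)
Lemma cross_orthogonal m n (L : 'M[F]_(m, n)) (M : 'M[F]_(n, m)) (c d : F) :
  (1 < m)%N -> c != 0 -> d != 0 ->
  (forall A : 'M_(m, n), c *: (A *m M) = d *: (L *m A^T)) -> L = 0 /\ M = 0.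
Proof.
move=> m_gt1 c0 d0 LM.
have M0 : M = 0.
  apply/matrixP => j y; have [i yi] := exists_neq y m_gt1.
  have /matrixP/(_ i y) := LM (delta_mx i j); rewrite trmx_delta !mxE.
  rewrite (bigD1 j) //= big1 => [|l /negPf lj]; last by rewrite mxE lj andbF mul0r.
  rewrite mxE !eqxx mul1r addr0 big1 => [|l _]; last by rewrite mxE (negPf yi) andbF mulr0.
  by move=> /eqP; rewrite mulr0 mulf_eq0 (negPf c0) => /eqP ->.
split=> //; case: m => // m in m_gt1 L M LM M0 *.
apply: (@mulmx_all0l R k _ m.+1 _ _ (ltn0Sn m)) => B.
have := LM B^T; rewrite M0 mulmx0 scaler0 trmxK => /esym/eqP.
by rewrite scaler_eq0 (negPf d0) => /eqP.
Qed.

Lemma specsum_pow_eq0 (q : R) m n (A : 'M[F]_(m, n)) :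
  specsum (pow_re q) A^emb = 0 -> A = 0.
Proof.
rewrite specsumE => /eqP; rewrite psumr_eq0 => [/allP H|i _]; last first.
  by rewrite /pow_re ler0c powR_ge0.
apply/adjmx_mul_eq0/(@map_complex_eq0 R k); rewrite gram_complex.
apply: spectral_diag_gram0; apply/rowP => i; rewrite mxE.
have /(_ i) := H; rewrite mem_index_enum /= /pow_re eq_complex /= eqxx andbT.
move=> /(_ isT)/eqP/powR_eq0_eq0 E.
have l0 : 0 <= spectral_diag (gram A^emb) 0 i.
  by apply: (@spectrum_gram_ge0 _ _ _ A^emb); rewrite map_f ?mem_enum.
by rewrite -(ge0_ReK l0) E.
Qed.

Lemma unitary_complex n (U : 'M[F]_n) : unitary_mx U -> U^emb \is unitarymx.
Proof.
move=> UU; apply/unitarymxP/mulmx1C.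
by rewrite -map_adjmx -map_mxM UU map_mx1.
Qed.

Lemma schatten_normal_form (p : R) m n r s q1 q2 r0 s0
    (er : (m * q1 + n * q2 + r0)%N = r) (es : (n * q1 + m * q2 + s0)%N = s)
    (U : 'M[F]_r) (V : 'M[F]_s) (Q1 : 'M[F]_q1) (Q2 : 'M[F]_q2) (A : 'M[F]_(m, n)) :
  0 < p -> unitary_mx U -> unitary_mx V ->
  schatten p (U *m castmx (er, es) (dsummx (dsummx (A *t Q1) (A^T *t Q2))
                                     (0 : 'M[F]_(r0, s0))) *m V) =
  schatten p A * schatten p (dsummx Q1 Q2).
Proof.
move=> p0 /unitary_complex UU /unitary_complex VV.
have p20 : 0 < p / 2 by rewrite divr_gt0.
have phiM := @pow_reM R (p / 2); have phi0 := pow_re0 p20.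
set D := dsummx _ (0 : 'M_(r0, s0)); set X := U *m _ *m V.
have XE : specsum (pow_re (p / 2)) X^emb =
    specsum (pow_re (p / 2)) A^emb * specsum (pow_re (p / 2)) (dsummx Q1 Q2)^emb.
  have -> : X^emb = U^emb *m (castmx (er, es) D)^emb *m V^emb by rewrite !map_mxM.
  rewrite specsum_unitary //.
  have -> : specsum (pow_re (p / 2)) (castmx (er, es) D)^emb =
            specsum (pow_re (p / 2)) D^emb.
    by case: _ / er X; case: _ / es; rewrite castmx_id.
  rewrite /D /dsummx !map_block_mx !map_mx0 !specsum_block specsum0 // addr0.
  by rewrite !map_mxT !specsum_tens // -map_trmx specsum_tr // mulrDr.
apply: (powR_injective p0); rewrite ?nnegrE ?mulr_ge0 ?schatten_ge0 //.
apply: complexI; apply: etrans (schatten_specsum p0 X) _; rewrite XE.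
rewrite powRM ?schatten_ge0 // [RHS]rmorphM.
by congr (_ * _); apply: esym; apply: schatten_specsum.
Qed.

Lemma decomposition_normal_form m n r s (Phi : 'M[F]_(m, n) -> 'M[F]_(r, s)) :
  (1 < m)%N -> block_decomposition Phi ->
  exists (U : 'M[F]_r) (V : 'M[F]_s) (q1 q2 : nat)
         (Q1 : 'M[F]_q1) (Q2 : 'M[F]_q2) (r0 s0 : nat)
         (er : (m * q1 + n * q2 + r0)%N = r) (es : (n * q1 + m * q2 + s0)%N = s),
    [/\ unitary_mx U /\ unitary_mx V, pos_diag Q1 /\ pos_diag Q2 &
        forall A, Phi A = U *m castmx (er, es)
          (dsummx (dsummx (A *t Q1) (A^T *t Q2)) (0 : 'M[F]_(r0, s0))) *m V].
Proof.
move=> m_gt1 [q1 [c1 [X1 [Y1 [q2 [c2 [X2 [Y2 [bf1 bf2 PhiE]]]]]]]]].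
have cross a b : (a < q1)%N -> (b < q2)%N ->
    (X1 a)^h *m X2 b = 0 /\ Y1 a *m (Y2 b)^h = 0.
  move=> aq bq; apply: (@cross_orthogonal _ _ _ _ (c1 a) (c2 b)) => // [||A].
  - by rewrite gt_eqF // (bf_gt0 bf1).
  - by rewrite gt_eqF // (bf_gt0 bf2).
  have := mulmxA (X1 a)^h (Phi A) (Y2 b)^h.
  rewrite (bf_left bf1) // (bf_right bf2) // -scalemxAl -scalemxAr => E.
  by rewrite !mulmxA in E; rewrite mulmxA E.
pose W := row_mx (assemble q1 X1) (assemble q2 X2).
pose T := row_mx (assemble q1 (fun a => (Y1 a)^h)) (assemble q2 (fun a => (Y2 a)^h)).
have WW : W^h *m W = 1%:M.
  apply: isometry_row_mx.
  - exact: assemble_isometry (bf_orthX bf1).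
  - by apply: assemble_cross => a b aq bq; case: (cross a b aq bq).
  - exact: assemble_isometry (bf_orthX bf2).
have TT : T^h *m T = 1%:M.
  apply: isometry_row_mx.
  - by apply: assemble_isometry => a b; rewrite adjmxK; apply: (bf_orthY bf1).
  - by apply: assemble_cross => a b aq bq; rewrite adjmxK; case: (cross a b aq bq).
  - by apply: assemble_isometry => a b; rewrite adjmxK; apply: (bf_orthY bf2).
have er := subnKC (isometry_leq WW); have es := subnKC (isometry_leq TT).
have [W0 W0W0] := isometry_complete WW er.
have [T0 T0T0] := isometry_complete TT es.
pose Q q (c : nat -> F) : 'M[F]_q := diag_mx (\row_(a < q) c a).
have Qpos q c : (forall a, (a < q)%N -> 0 < c a) -> pos_diag (Q q c).
  by move=> c0; split=> [|i]; rewrite ?diag_mx_is_diag // !mxE eqxx mulr1n c0.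
exists (castmx (erefl r, er) (row_mx W W0)), (castmx (es, erefl s) (row_mx T T0)^h).
exists q1, q2, (Q q1 c1), (Q q2 c2), _, _, er, es; split.
- split; first exact: unitary_castmx.
  rewrite -adjmx_castmx /unitary_mx adjmxK; apply: mulmx1C.
  exact: unitary_castmx.
- by split; apply: Qpos => a aq; [apply: (bf_gt0 bf1 aq) | apply: (bf_gt0 bf2 aq)].
move=> A; rewrite castmx_sandwich.
have adj_row r' d d' (B : 'M[F]_(r', d)) (B' : 'M[F]_(r', d')) :
   (row_mx B B')^h = col_mx B^h B'^h by rewrite /adjmx map_row_mx tr_row_mx.
rewrite adj_row /dsummx mul_row_block !mulmx0 !addr0 mul_row_col mul0mx addr0.
rewrite mul_row_block !mulmx0 addr0 add0r adj_row mul_row_col.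
rewrite !assemble_tens !assemble_adj PhiE /family_sum.
by congr (_ + _); apply: eq_bigr => a _; rewrite adjmxK.
Qed.

End Assembly.

Theorem theorem4p1 (R : realType) (k : scalar_kind) (m n r s : nat)
    (hm : (2 <= m)%N) (hn : (2 <= n)%N) (hr : (1 <= r)%N) (hs : (1 <= s)%N)
    (p : R) (hp : 0 < p < 2 \/ 2 < p)
    (Phi : {linear 'M[scalar_field R k]_(m, n) -> 'M[scalar_field R k]_(r, s)}) :
  [<-> (* a *)
       forall A : 'M[scalar_field R k]_(m, n), schatten p (Phi A) = schatten p A;
       (* b *)
       forall A : 'M[scalar_field R k]_(m, n), (\rank A <= 2)%N ->
         schatten p (Phi A) = schatten p A;
       (* c: q1 = 0 or q2 = 0 means that Q1 or Q2 is vacuous; the zero block in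
          the corner has size r0 x s0 *)
       exists (U : 'M[scalar_field R k]_r) (V : 'M[scalar_field R k]_s) (q1 q2 : nat)
              (Q1 : 'M[scalar_field R k]_q1) (Q2 : 'M[scalar_field R k]_q2)
              (r0 s0 : nat)
              (er : (m * q1 + n * q2 + r0)%N = r)
              (es : (n * q1 + m * q2 + s0)%N = s),
         [/\ unitary_mx U /\ unitary_mx V,
             pos_diag Q1 /\ pos_diag Q2,
             schatten p (dsummx Q1 Q2) = 1 &
             forall A : 'M[scalar_field R k]_(m, n),
               Phi A = U *m castmx (er, es)
                             (dsummx (dsummx (A *t Q1) (A^T *t Q2))
                                     (0 : 'M[scalar_field R k]_(r0, s0))) *m V]].
Proof.
have p0 : 0 < p by case: hp => [/andP[]//|]; lra.
tfae.
- by move=> PhiP A _.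
- move=> PhiP; have PhiD := schatten_preserver_disjoint hp PhiP.
  have [U [V [q1 [q2 [Q1 [Q2 [r0 [s0 [er [es [[UU VV] Qpos PhiE]]]]]]]]]]] :=
    decomposition_normal_form hm (disjointness_preserver_decomposition hm hn PhiD).
  exists U, V, q1, q2, Q1, Q2, r0, s0, er, es; split=> //.
  pose E : 'M[scalar_field R k]_(m, n) := delta_mx (Ordinal (ltnW hm)) (Ordinal (ltnW hn)).
  have S0 : schatten p E != 0.
    apply/eqP => S0; have := schatten_specsum p0 E; rewrite S0 powR0 ?gt_eqF //.
    move=> /esym/specsum_pow_eq0/eqP.
    by rewrite -mxrank_eq0 mxrank_delta.
  apply: (mulfI S0); rewrite mulr1 -(schatten_normal_form er es _ _ _ p0 UU VV) -PhiE.
  by apply: PhiP; rewrite mxrank_delta.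
move=> [U [V [q1 [q2 [Q1 [Q2 [r0 [s0 [er [es [[UU VV] Qpos S1 PhiE]]]]]]]]]]] A.
by rewrite PhiE schatten_normal_form // S1 mulr1.
Qed.
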